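(* Let $t$ be any irrational in $(0,1)$ for which there exist two subsequences of convergents $\{c_{f_n}/d_{f_n}\}$ and $\{c_{g_n}/d_{g_n}\}$ of the regular continued fraction of $t$, integers $r,u\in\{0,1,2,3,4\}$ and integers $s,v\in\{1,2,3,4\}$ such that, for all $n$: (1) $c_{f_n}\equiv r$, $d_{f_n}\equiv s$, $c_{g_n}\equiv u$, $d_{g_n}\equiv v \pmod 5$; (2) for $h_n=f_n$ and for $h_n=g_n$, $$a_{h_n+1}>2\pi(d_{h_n}+1)^2\phi^{d_{h_n}^2+2d_{h_n}}.$$ Suppose further that (3) $R(\exp(2\pi i r/s))=R_a\neq R_b=R(\exp(2\pi i u/v))$ for some $a,b\in\{1,2,\dots,10\}$. Let $S^{\diamond}$ denote the set of all $t\in(0,1)$ satisfying (1), (2) and (3), and set $G=\{\exp(2\pi i t): t\in S^{\diamond}\}$. Then $G$ is an uncountable set of measure zero such that if $y\in G$, then $K(y)$ does not converge generally.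
   Context: $\phi=(\sqrt5+1)/2$. For irrational $t\in(0,1)$, $[0,a_1,a_2,\dots]$ is its regular continued fraction expansion and $c_i/d_i$ is its $i$-th convergent, in lowest terms ($c_0/d_0=0/1$). $K(x)$ denotes the continued fraction $$K(x)=1+\cfrac{x}{1+\cfrac{x^2}{1+\cfrac{x^3}{1+\ddots}}}$$ and, where it converges, also its value. The Rogers-Ramanujan continued fraction is $R(x)=x^{1/5}/K(x)$, where for $x=\exp(2\pi i\tau)$ with $0\le\tau<1$ we take $x^{1/5}=\exp(2\pi i\tau/5)$. By a theorem of Schur, $K(x)$ converges at every primitive $m$-th root of unity with $5\nmid m$, so $R(\exp(2\pi i r/s))$ and $R(\exp(2\pi i u/v))$ are defined for the $r,s,u,v$ considered. The numbers $R_j$ are $$R_j=\begin{cases}-\phi\exp(2\pi i j/5), & 1\le j\le 5,\\[1mm] \dfrac{\exp(2\pi i j/5)}{\phi}, & 6\le j\le 10;\end{cases}$$ they are the ten values taken by $R(x)$ at roots of unity. Let $\hat{\mathbb{C}}=\mathbb{C}\cup\{\infty\}$, with the chordal metric $d(w,z)=\dfrac{|z-w|}{\sqrt{1+|w|^2}\sqrt{1+|z|^2}}$ for finite $w,z$, $d(w,\infty)=\dfrac{1}{\sqrt{1+|w|^2}}$ for finite $w$, and $d(\infty,\infty)=0$. For a continued fraction $b_0+\cfrac{\alpha_1}{b_1+\cfrac{\alpha_2}{b_2+\ddots}}$ with $n$-th convergent $A_n/B_n$, put $$S_n(w)=b_0+\cfrac{\alpha_1}{b_1+\ddots+\cfrac{\alpha_n}{b_n+w}}=\frac{A_n+wA_{n-1}}{B_n+wB_{n-1}},\qquad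 S_n(\infty)=\frac{A_{n-1}}{B_{n-1}}.$$ The continued fraction converges generally to $f\in\hat{\mathbb{C}}$ if there exist sequences $\{v_n\},\{w_n\}\subset\hat{\mathbb{C}}$ with $\liminf_{n\to\infty} d(v_n,w_n)>0$ and $\lim_{n\to\infty}S_n(v_n)=\lim_{n\to\infty}S_n(w_n)=f$. It converges generally if it converges generally to some $f\in\hat{\mathbb{C}}$. *)

(* Defs.v *)
From HB Require Import structures.
From mathcomp Require Import all_boot all_order all_algebra.
From mathcomp Require Import all_classical all_reals all_analysis.
From mathcomp Require Import complex.

Set Implicit Arguments.
Unset Strict Implicit.
Unset Printing Implicit Defensive.

Import Order.TTheory GRing.Theory Num.Theory.
Import numFieldNormedType.Exports ComplexField.Normc.

Local Open Scope classical_set_scope.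
Local Open Scope ring_scope.

Section ContinuedFractions.
Variable T : pzSemiRingType.
Variables alpha b : nat -> T.

(* The pair (X_{n-1}, X_n), where X_{-1} = x, X_0 = y and
   X_k = b_k X_{k-1} + alpha_k X_{k-2} for k >= 1. The values b 0 (in the
   numerator) and b n, alpha n for n >= 1 are used; alpha 0 is not. *)
Fixpoint cf_rec (x y : T) (n : nat) : T * T :=
  if n is m.+1 then
    let: (p, q) := cf_rec x y m in (q, b m.+1 * q + alpha m.+1 * p)
  else (x, y).

(* A_n and B_n; the primed versions are A_{n-1} and B_{n-1}, with the usual
   A_{-1} = 1 and B_{-1} = 0. *)
Definition cf_num (n : nat) : T := (cf_rec 1 (b 0) n).2.
Definition cf_den (n : nat) : T := (cf_rec 0 1 n).2.
Definition cf_num' (n : nat) : T := (cf_rec 1 (b 0) n).1.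
Definition cf_den' (n : nat) : T := (cf_rec 0 1 n).1.

End ContinuedFractions.

Section RegularContinuedFraction.
Variable R : realType.

(* Complete quotients of a nonnegative real t; for irrational t the inverse is
   never taken at 0. *)
Fixpoint complete_quotient (t : R) (n : nat) : R :=
  if n is m.+1 then
    let xi := complete_quotient t m in (xi - (Num.truncn xi)%:R)^-1
  else t.

Definition partial_quotient (t : R) (n : nat) : nat :=
  Num.truncn (complete_quotient t n).

Definition conv_num (t : R) (n : nat) : nat :=
  cf_num (fun=> 1%N) (partial_quotient t) n.
Definition conv_den (t : R) (n : nat) : nat :=
  cf_den (fun=> 1%N) (partial_quotient t) n.

Lemma coprime_conv (t : R) (n : nat) : coprime (conv_num t n) (conv_den t n).
Proof.
rewrite /conv_num /conv_den /cf_num /cf_den.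
set a := partial_quotient t.
suff : let: (p', p) := cf_rec (fun=> 1%N) a 1%N (a 0) n in
       let: (q', q) := cf_rec (fun=> 1%N) a 0%N 1%N n in
       (p * q' + 1 = p' * q)%N \/ (p' * q + 1 = p * q')%N.
  case: (cf_rec _ _ _ _ n) => p' p; case: (cf_rec _ _ _ _ n) => q' q /= H.
  rewrite /coprime -dvdn1; set g := gcdn p q.
  have gp m : (g %| p * m)%N by rewrite dvdn_mulr// dvdn_gcdl.
  have gq m : (g %| m * q)%N by rewrite dvdn_mull// dvdn_gcdr.
  by case: H => H; [rewrite -(dvdn_addr _ (gp q')) H|
                    rewrite -(dvdn_addr _ (gq p')) H].
elim: n => [|n] /=; first by left; rewrite muln0 muln1.
case: (cf_rec _ _ _ _ n) => p' p; case: (cf_rec _ _ _ _ n) => q' q /=.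
have E (x y z : nat) : (x * y + 1 * z)%R = (x * y + z)%N by rewrite mul1r.
rewrite !E !mulnDl !mulnDr => -[H|H]; [right|left].
- by rewrite -addnA H addnC mulnCA mulnA addnC.
- by rewrite -addnA H mulnCA mulnA.
Qed.

End RegularContinuedFraction.

Section ExtendedPlane.
Variable R : realType.

(* The extended complex plane; None is the point at infinity. *)
Definition Chat : Type := option R[i].

Definition chordal (z w : Chat) : R :=
  match z, w with
  | Some z, Some w =>
      normc (z - w) /
        (Num.sqrt (1 + normc w ^+ 2) * Num.sqrt (1 + normc z ^+ 2))
  | Some z, None | None, Some z => (Num.sqrt (1 + normc z ^+ 2))^-1
  | None, None => 0
  end.

Definition Chat_cvg (u : nat -> Chat) (f : Chat) : Prop :=
  chordal (u n) f @[n --> \oo] --> (0 : R).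

(* The quotient p / q in the extended plane, for p and q not both zero. *)
Definition Chat_div (p q : R[i]) : Chat :=
  if q == 0 then None else Some (p / q).

Variables alpha b : nat -> R[i].

Definition cf_S (n : nat) (w : Chat) : Chat :=
  if w is Some z then
    Chat_div (cf_num alpha b n + z * cf_num' alpha b n)
             (cf_den alpha b n + z * cf_den' alpha b n)
  else Chat_div (cf_num' alpha b n) (cf_den' alpha b n).

Definition cf_converges (f : Chat) : Prop :=
  Chat_cvg (fun n => Chat_div (cf_num alpha b n) (cf_den alpha b n)) f.

Definition cf_converges_generally_to (f : Chat) : Prop :=
  exists v w : nat -> Chat,
    [/\ (0 < limn_einf (fun n => (chordal (v n) (w n))%:E))%E,
        Chat_cvg (fun n => cf_S n (v n)) f &
        Chat_cvg (fun n => cf_S n (w n)) f].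

Definition cf_converges_generally : Prop :=
  exists f : Chat, cf_converges_generally_to f.

End ExtendedPlane.

Section RogersRamanujan.
Variable R : realType.

(* exp (i theta) *)
Definition expi (theta : R) : R[i] := (cos theta +i* sin theta)%C.

(* exp (2 pi i t) *)
Definition exp2pii (t : R) : R[i] := expi (2 * pi * t).

Definition golden : R := (Num.sqrt 5 + 1) / 2.

(* K(x) is the continued fraction with elements K_alpha x and K_b. *)
Definition K_alpha (x : R[i]) (n : nat) : R[i] := x ^+ n.
Definition K_b (n : nat) : R[i] := 1.

(* rr_value x rho: K(x) converges to a finite nonzero value, and R(x) = rho. *)
Definition rr_value (x rho : R[i]) : Prop :=
  exists (tau : R) (k : R[i]),
    [/\ 0 <= tau < 1, x = exp2pii tau,
        cf_converges (K_alpha x) K_b (Some k), k != 0 &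
        rho = exp2pii (tau / 5) / k].

Definition RR (j : nat) : R[i] :=
  if (j <= 5)%N then - (golden%:C)%C * exp2pii (j%:R / 5)
  else exp2pii (j%:R / 5) / (golden%:C)%C.

Definition large_partial_quotient (t : R) (h : nat) : Prop :=
  let d := conv_den t h in
  2 * pi * (d.+1)%:R ^+ 2 * golden ^+ (d ^ 2 + 2 * d)
    < (partial_quotient t h.+1)%:R.

Definition Sdiamond : set R := [set t : R |
  [/\ 0 < t < 1, irrational t &
  exists (f g : nat -> nat) (r s u v : nat),
    [/\ {homo f : m n / (m < n)%N} /\ {homo g : m n / (m < n)%N},
        [/\ (r < 5)%N, (u < 5)%N, (0 < s < 5)%N & (0 < v < 5)%N],
        forall n,
          [/\ conv_num t (f n) = r %[mod 5], conv_den t (f n) = s %[mod 5],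
              conv_num t (g n) = u %[mod 5] & conv_den t (g n) = v %[mod 5]],
        forall n,
          large_partial_quotient t (f n) /\ large_partial_quotient t (g n) &
        exists a b : nat,
          [/\ (1 <= a <= 10)%N, (1 <= b <= 10)%N,
              rr_value (exp2pii (r%:R / s%:R)) (RR a),
              rr_value (exp2pii (u%:R / v%:R)) (RR b) & RR a != RR b]]]].

(* Measure zero for arc length on the unit circle. *)
Definition circle_null (G : set R[i]) : Prop :=
  (@lebesgue_measure R).-negligible
    [set theta : R | 0 <= theta < 2 * pi /\ G (expi theta)].

End RogersRamanujan.

(* Main.v *)
Require Import Defs.
From mathcomp Require Import all_boot all_order all_algebra.
From mathcomp Require Import all_classical all_reals all_analysis.
From mathcomp Require Import complex borel_hierarchy ring lra zify.

(** Divergence. Let y = exp (2 pi i t) with t in the set, let c / d be a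
    convergent of t followed by a huge partial quotient, and let
    x = exp (2 pi i c / d), a primitive d-th root of unity. The point y is so
    close to x that the first d - 1 steps of K(y) and of K(x) almost agree
    ([cf_bounded_perturb]). For K(x) the matrix with rows
    (B_{d-2}, B_{d-1}) and (A_{d-2}, A_{d-1}) is the product
    J D(x) J D(x^2) J ... D(x^{d-1}) J with J and the diagonal matrices
    D(a) = diag (a, 1) symmetric. Transposition reverses the word, and so does
    complex conjugation, because the conjugate of x^k is x^{d-k}; hence the
    matrix is Hermitian. Its determinant has modulus 1, and its trace is 1
    ([primitive_cf_trace]): after the substitution of z x^k for x^k the trace
    becomes a polynomial in z of degree less than d, which is invariant under
    z -> z x by cyclicity, so it is constant and can be read off at z = 0.
    A Hermitian 2 x 2 matrix with trace 1 and determinant of modulus 1 has its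
    entries bounded by an absolute constant ([primitive_cf_bounded]).

    So along the indices n = d - 1 the maps S_n of K(y) are given by matrices
    with bounded entries and determinant of modulus 1. Such maps contract the
    chordal metric by at most a fixed factor ([chordal_cf_S]); they cannot send
    two sequences that stay apart to the same limit, which is what general
    convergence asks for ([not_cvg_generally]).

    Measure. A large partial quotient puts 2 pi t within 2^(-d) / (d + 1) of
    some 2 pi c / d with 0 <= c <= d. The arcs of twice this radius around all
    such points have summable total length, and Borel-Cantelli applies
    ([limsup_rational_arcs_null]).

    Uncountability. Since K(1) = phi and K(-1) = phi - 1, the classes
    (r, s) = (0, 1) and (u, v) = (1, 2) give two different values of R. The
    fractions (10 j + 5) / 16^k and (10 j + 1) / (2 * 16^k) are in lowest terms
    and lie in these two classes. By Legendre's criterion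
    ([legendre_convergent]) an irrational t that is close enough to such a
    fraction has it as a convergent, and being closer still forces the next
    partial quotient to be as large as prescribed ([partial_quotient_gt]). For
    each class and each N, the t that are close to such a fraction with k >= N
    form a dense open subset of the positive reals, so that by Baire's theorem no
    sequence of points can exhaust the set. *)

Set Implicit Arguments.
Unset Strict Implicit.
Unset Printing Implicit Defensive.

Import Order.TTheory GRing.Theory Num.Theory.
Import numFieldNormedType.Exports ComplexField.Normc.

Local Open Scope classical_set_scope.
Local Open Scope ring_scope.

Local Arguments normc : simpl never.

(** * The matrix of a continued fraction with unit partial denominators *)

Lemma iota_rcons (m n : nat) : iota m n.+1 = rcons (iota m n) (m + n)%N.
Proof. by rewrite -cats1 -[n.+1]addn1 iotaD. Qed.

Section TwoByTwo.
Variable A : comPzRingType.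

Definition mx2 (a b c d : A) : 'M[A]_2 :=
  \matrix_(i < 2, j < 2)
    if i == 0 then (if j == 0 then a else b) else (if j == 0 then c else d).

Lemma ord2P (P : 'I_2 -> Prop) : P 0 -> P 1 -> forall i, P i.
Proof.
move=> P0 P1 [[|[|//]] i2].
- by congr P: P0; apply: val_inj.
- by congr P: P1; apply: val_inj.
Qed.

Lemma mx2_mul (a b c d a' b' c' d' : A) :
  mx2 a b c d *m mx2 a' b' c' d' =
  mx2 (a * a' + b * c') (a * b' + b * d') (c * a' + d * c') (c * b' + d * d').
Proof.
by apply/matrixP; apply: ord2P; apply: ord2P;
  rewrite !mxE big_ord_recl big_ord1 !mxE.
Qed.

Lemma mx2_tr (a b c d : A) : (mx2 a b c d)^T = mx2 a c b d.
Proof. by apply/matrixP; apply: ord2P; apply: ord2P; rewrite !mxE. Qed.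

Lemma mx2_trace (a b c d : A) : \tr (mx2 a b c d) = a + d.
Proof. by rewrite /mxtrace big_ord_recl big_ord1 !mxE. Qed.

End TwoByTwo.

Section Continuants.
Variable A : comNzRingType.

(** One step of the recurrence multiplies by D(alpha_k) J. The step matrix is
    split in this way because both factors are symmetric. *)
Let J : 'M[A]_2 := mx2 0 1 1 1.
Let D (a : A) : 'M[A]_2 := mx2 a 0 0 1.

Fixpoint period_mx (l : seq A) : 'M[A]_2 :=
  if l is a :: l' then J *m D a *m period_mx l' else J.

Lemma period_mx_rcons (l : seq A) (a : A) :
  period_mx (rcons l a) = period_mx l *m D a *m J.
Proof. by elim: l => //= b l ->; rewrite !mulmxA. Qed.

(** The word is a palindrome up to the order of its letters, and transposition
    reverses a product of symmetric matrices. *)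
Lemma period_mx_tr (l : seq A) : (period_mx l)^T = period_mx (rev l).
Proof.
have JT : J^T = J by rewrite mx2_tr.
have DT a : (D a)^T = D a by rewrite mx2_tr.
elim: l => //= a l IH.
by rewrite rev_cons period_mx_rcons !trmx_mul IH JT DT mulmxA.
Qed.

(** Closing the word with one more letter b gives J D(a_1) ... J D(a_n) J D(b),
    whose trace has no distinguished starting point. *)
Definition cyclic_trace (l : seq A) (b : A) : A := \tr (period_mx l *m D b).

Lemma cyclic_trace_rot (l : seq A) (a b : A) :
  cyclic_trace (a :: l) b = cyclic_trace (rcons l b) a.
Proof.
rewrite /cyclic_trace /= period_mx_rcons -mulmxA mxtrace_mulC.
by rewrite !mulmxA.
Qed.

(** The columns of J are the initial values (B_{-1}, A_{-1}) and (B_0, A_0), and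
    right multiplication by D(a) J is one step of the recurrence on columns. *)
Lemma period_mxE (alpha : nat -> A) (n : nat) :
  let P := cf_rec alpha (fun=> 1) 1 1 n in
  let Q := cf_rec alpha (fun=> 1) 0 1 n in
  period_mx [seq alpha k | k <- iota 1 n] = mx2 Q.1 Q.2 P.1 P.2.
Proof.
elim: n => [|n IH]; first by [].
rewrite /= in IH; rewrite iota_rcons map_rcons period_mx_rcons {}IH add1n /=.
case: (cf_rec _ _ _ _ n) => p p'; case: (cf_rec _ _ _ _ n) => q q' /=.
by rewrite !mx2_mul; congr mx2; ring.
Qed.

Lemma cf_det (alpha : nat -> A) (n : nat) :
  cf_num alpha (fun=> 1) n * cf_den' alpha (fun=> 1) n -
  cf_num' alpha (fun=> 1) n * cf_den alpha (fun=> 1) n =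
  (-1) ^+ n.+1 * \prod_(k < n) alpha k.+1.
Proof.
rewrite /cf_num /cf_den /cf_num' /cf_den'.
elim: n => [|n] /=; first by rewrite big_ord0; ring.
case: (cf_rec _ _ _ _ n) => p' p; case: (cf_rec _ _ _ _ n) => q' q /= IH.
transitivity (- alpha n.+1 * (p * q' - p' * q)); first by ring.
by rewrite IH big_ord_recr /= [in RHS]exprS; ring.
Qed.

End Continuants.

(** * The trace at a root of unity *)

Section RootOfUnity.
Variable F : fieldType.
Implicit Types (x z : F).

(** A factor alpha_k enters with the value two indices earlier, so the degree
    grows by one every two steps; k records the starting degrees. *)
Lemma cf_rec_size (alpha : nat -> {poly F}) (p q : {poly F}) (k n : nat) :
  (forall j, size (alpha j) <= 2)%N ->
  (size p <= k./2)%N -> (size q <= k.+1./2)%N ->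
  let r := cf_rec alpha (fun=> 1) p q n in
  (size r.1 <= (n + k)./2)%N /\ (size r.2 <= (n + k).+1./2)%N.
Proof.
move=> sa sp sq; elim: n => [|n] //=.
case: (cf_rec _ _ _ _ n) => u v /= [su sv]; split => //.
rewrite mul1r (leq_trans (size_polyD _ _))// geq_max; apply/andP; split.
  by apply: (leq_trans sv); lia.
rewrite (leq_trans (size_polyMleq _ _))//.
have := sa n.+1; move: (size _) (size _) su => a b; lia.
Qed.

Lemma cf_rec_horner (alpha : nat -> {poly F}) (p q : {poly F}) (z : F) (n : nat) :
  let r := cf_rec alpha (fun=> 1) p q n in
  cf_rec (fun k => (alpha k).[z]) (fun=> 1) p.[z] q.[z] n = (r.1.[z], r.2.[z]).
Proof.
elim: n => [|n /= ->] //=.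
by case: (cf_rec _ _ _ _ n) => u v /=; rewrite !hornerE.
Qed.

(** Let f(z) be the trace of the closed word with letters z x, ..., z x^d.
    Rotating the word gives f(z x) = f(z), so f takes the value f(1) at the d
    points x^k; as deg f < d, it is constant, and f(0) = 1. *)
Lemma primitive_cf_trace x (d : nat) : d.-primitive_root x ->
  cf_num (fun k => x ^+ k) (fun=> 1) d.-1 +
  cf_den' (fun k => x ^+ k) (fun=> 1) d.-1 = 1.
Proof.
move=> px; have d0 := prim_order_gt0 px; have xd := prim_expr_order px.
pose alpha k : {poly F} := x ^+ k *: 'X.
pose P := cf_rec alpha (fun=> 1) 1 1 d.-1.
pose Q := cf_rec alpha (fun=> 1) 0 1 d.-1.
pose f : {poly F} := P.2 + 'X * Q.1.
have sizef : (size f <= d)%N.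
  have sa j : (size (alpha j) <= 2)%N.
    by rewrite (leq_trans (size_scale_leq _ _))// size_polyX.
  have [_ sP] := @cf_rec_size alpha 1 1 2 d.-1 sa (eq_leq (size_poly1 F))
    (eq_leq (size_poly1 F)).
  have [sQ _] := @cf_rec_size alpha 0 1 1 d.-1 sa (eq_leq (size_poly0 F))
    (eq_leq (size_poly1 F)).
  rewrite (leq_trans (size_polyD _ _))// geq_max; apply/andP; split.
    by apply: (leq_trans sP); lia.
  rewrite (leq_trans (size_polyMleq _ _))// size_polyX -/Q.
  by move: sQ; rewrite -/Q; lia.
have alphaz z : (fun k => (alpha k).[z]) = (fun k => z * x ^+ k).
  by apply: funext => k; rewrite !hornerE mulrC.
have fz z : f.[z] =
    cyclic_trace [seq z * x ^+ k | k <- iota 1 d.-1] (z * x ^+ d).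
  rewrite /cyclic_trace (period_mxE (fun k => z * x ^+ k)) -!alphaz.
  have := cf_rec_horner alpha 1 1 z d.-1; rewrite !hornerE => ->.
  have := cf_rec_horner alpha 0 1 z d.-1; rewrite !hornerE => ->.
  by rewrite mx2_mul mx2_trace /= xd /f !hornerE -/P -/Q /=; ring.
have rot z : f.[z * x] = f.[z].
  rewrite !fz; move: xd d0; case: (d) => // -[|e] xd _; rewrite ![_.-1]/=.
    by rewrite xd !mulr1 -[x]expr1 xd mulr1.
  have -> : [seq z * x ^+ k | k <- iota 1 e.+1] =
      z * x :: [seq z * x * x ^+ k | k <- iota 1 e].
    rewrite -[iota 1 e.+1]/(1%N :: iota (1 + 1) e) iotaDl /= -map_comp expr1.
    by congr cons; apply: eq_map => k /=; rewrite -mulrA -exprS.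
  rewrite [RHS]cyclic_trace_rot iota_rcons map_rcons xd mulr1; congr cyclic_trace.
  by congr rcons; rewrite -mulrA -exprS add1n xd.
have fxk k : f.[x ^+ k] = f.[1].
  by elim: k => [|k IH]; rewrite ?expr0// exprSr rot.
have fc : f = f.[1]%:P.
  apply/eqP; rewrite -subr_eq0; apply/eqP.
  apply: (@roots_geq_poly_eq0 _ _ [seq x ^+ k | k <- iota 0 d]).
  - by apply/allP => y /mapP[k _ ->]; rewrite /root hornerD hornerN hornerC fxk subrr.
  - rewrite map_inj_in_uniq ?iota_uniq// => i j; rewrite !mem_iota !add0n /=.
    move=> id jd /eqP; rewrite (eq_prim_root_expr px) !modn_small//.
    by move/eqP.
  - rewrite size_map size_iota (leq_trans (size_polyD _ _))// geq_max sizef.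
    by rewrite size_polyN (leq_trans (size_polyC_leq1 _))//.
have f1 : f.[1] = f.[0] by rewrite [in RHS]fc hornerC.
have /= E1 := cf_rec_horner alpha 1 1 1 d.-1.
have /= E2 := cf_rec_horner alpha 0 1 1 d.-1.
have ax : (fun k => (alpha k).[1]) = (fun k => x ^+ k).
  by rewrite alphaz; apply: funext => k; rewrite mul1r.
move: E1 E2; rewrite ax !hornerE -/P -/Q => E1 E2.
rewrite /cf_num /cf_den' E1 E2 /=.
have -> : P.2.[1] + Q.1.[1] = f.[1] by rewrite /f !hornerE.
rewrite f1 /f !hornerE.
have /= := cf_rec_horner alpha 1 1 0 d.-1; rewrite !hornerE -/P alphaz.
have -> : cf_rec (fun k => 0 * x ^+ k) (fun=> 1) 1 1 d.-1 = (1, 1).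
  by elim: (d.-1) => //= n ->; rewrite !mul0r mul1r addr0.
by case.
Qed.

End RootOfUnity.

(** * The Hermitian matrix of a period *)

Section MatrixBounds.
Variable R : realType.
Implicit Types (x : R[i]) (alpha b : nat -> R[i]) (n d : nat) (C : R).

Lemma normc_ge0 x : 0 <= normc x.
Proof. by case: x => a b; rewrite /normc sqrtr_ge0. Qed.

Lemma normc_real (r : R) : normc (r%:C)%C = `|r|.
Proof. by rewrite /normc /= expr0n /= addr0 sqrtr_sqr. Qed.

Lemma normc_opp x : normc (- x) = normc x.
Proof. by case: x => a b; rewrite /normc /= !sqrrN. Qed.

Lemma normcB x y : normc (x - y) = normc (y - x).
Proof. by rewrite -normc_opp opprB. Qed.

Lemma normcX x n : normc (x ^+ n) = normc x ^+ n.
Proof. by elim: n => [|n IH]; rewrite ?expr0 ?normc1// !exprS normcM IH. Qed.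

Lemma mulc_conj x : x * (x^*)%C = ((normc x ^+ 2)%:C)%C.
Proof.
case: x => a b; rewrite /normc /= sqr_sqrtr ?addr_ge0 ?sqr_ge0//.
by apply/eqP; rewrite eq_complex /=; apply/andP; split; apply/eqP; ring.
Qed.

Lemma conjc_fixed x : (x^*)%C = x -> exists r : R, x = (r%:C)%C.
Proof.
case: x => a b /= [] /eqP; rewrite eq_sym -subr_eq0 opprK -mulr2n mulrn_eq0 /=.
by move=> /eqP ->; exists a.
Qed.

Lemma cf_det_norm alpha n : (forall k, normc (alpha k) = 1) ->
  normc (cf_num alpha (fun=> 1) n * cf_den' alpha (fun=> 1) n -
         cf_num' alpha (fun=> 1) n * cf_den alpha (fun=> 1) n) = 1.
Proof.
move=> a1; rewrite cf_det normcM normcX normc_opp normc1 expr1n mul1r.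
elim: n => [|n IH]; first by rewrite big_ord0 normc1.
by rewrite big_ord_recr normcM IH a1 mulr1.
Qed.

Definition cf_bounded alpha n C : Prop :=
  [/\ normc (cf_num alpha (fun=> 1) n) <= C,
      normc (cf_num' alpha (fun=> 1) n) <= C,
      normc (cf_den alpha (fun=> 1) n) <= C &
      normc (cf_den' alpha (fun=> 1) n) <= C].

Lemma period_mx_map_conj (l : seq R[i]) :
  map_mx (@conjc R) (period_mx l) = period_mx [seq (z^*)%C | z <- l].
Proof.
have mx2_map (u v w z : R[i]) : map_mx (@conjc R) (mx2 u v w z) =
    mx2 (u^*)%C (v^*)%C (w^*)%C (z^*)%C.
  by apply/matrixP; apply: ord2P; apply: ord2P; rewrite !mxE.
by elim: l => [|a l IH] /=; rewrite ?map_mxM /= ?IH ?mx2_map ?conjc0 ?conjc1.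
Qed.

(** The matrix of the word x, ..., x^{d-1} is Hermitian, say with diagonal
    entries a, b and off-diagonal entry of modulus w. Then a + b = 1 and
    |a b - w^2| = 1, whence 0 <= w^2 <= 1 + a (1 - a), which confines a to the
    interval between the roots of a^2 = a + 1. *)
Lemma primitive_cf_bounded x d : d.-primitive_root x -> normc x = 1 ->
  cf_bounded (fun k => x ^+ k) d.-1 2.
Proof.
move=> px x1; have d0 := prim_order_gt0 px; have xd := prim_expr_order px.
have xconj k : (k <= d)%N -> ((x ^+ k)^*)%C = x ^+ (d - k).
  move=> kd; have xk0 : x ^+ k != 0.
    by apply/eqP => /(congr1 (@normc R)); rewrite normcX x1 expr1n normc0;
      apply/eqP; rewrite oner_eq0.
  apply: (mulfI xk0); rewrite mulc_conj normcX x1 !expr1n -exprD subnKC//.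
pose l := [seq x ^+ k | k <- iota 1 d.-1].
have lrev : [seq (z^*)%C | z <- l] = rev l.
  rewrite /l -map_rev -map_comp.
  have -> : rev (iota 1 d.-1) = [seq (d - k)%N | k <- iota 1 d.-1].
    apply: (@eq_from_nth _ 0%N); first by rewrite size_rev size_map.
    move=> i; rewrite size_rev size_iota => id.
    by rewrite nth_rev ?(nth_map 0%N) ?size_iota// !nth_iota//; lia.
  rewrite -map_comp; apply/eq_in_map => k; rewrite mem_iota => /andP[k1 kd] /=.
  by apply: xconj; lia.
have := congr1 (map_mx (@conjc R)) (period_mx_tr l).
rewrite period_mx_map_conj -lrev -map_comp (eq_map (@conjcK R)) map_id.
have alpha1 k : normc (x ^+ k) = 1 by rewrite normcX x1 expr1n.
have := cf_det_norm d.-1 alpha1.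
have tr1 := primitive_cf_trace px.
rewrite /l (period_mxE (fun k => x ^+ k)) /=; move: tr1.
rewrite /cf_bounded /cf_num /cf_den /cf_num' /cf_den'.
case: (cf_rec _ _ _ _ _) => A' A; case: (cf_rec _ _ _ _ _) => B' B /= tr1.
move=> det1; rewrite mx2_tr => /matrixP E.
have := E 0 0; rewrite !mxE /= => /conjc_fixed[b Bb].
have := E 1 1; rewrite !mxE /= => /conjc_fixed[a Aa].
have := E 0 1; rewrite !mxE /= => AB.
have ab1 : a + b = 1.
  by move: tr1; rewrite Aa Bb -rmorphD => /(congr1 (@complex.Re R)).
have := det1; rewrite -AB Aa Bb mulc_conj -rmorphM -rmorphB normc_real => dd.
have normB : normc (A'^*)%C = normc A'.
  by case: (A') => u v; rewrite /normc /= sqrrN.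
rewrite normB; set w := normc A' in dd *.
have w0 : 0 <= w := normc_ge0 _.
have {}dd : w ^+ 2 <= a * b + 1.
  have : normc ((a * b - w ^+ 2)%:C)%C = 1 := dd.
  rewrite normc_real => /eqP; rewrite eqr_norml => /andP[/orP[]/eqP ? _]; lra.
have {}Bb : b = 1 - a by lra.
subst b; have a2 : `|a| <= 2 /\ `|1 - a| <= 2.
  by split; rewrite ler_norml; apply/andP; split; nra.
have w2 : w <= 2.
  by rewrite -(@ler_pXn2r _ 2) ?nnegrE//; have := sqr_ge0 (a - 1 / 2); nra.
by case: a2 => a2 b2; split; rewrite ?normB ?normc_real.
Qed.

End MatrixBounds.

(** * Moebius maps and general convergence *)

Section Chordal.
Variable R : realType.
Implicit Types (p q f : R[i] * R[i]) (z w : Chat R) (C : R).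

(** Points of the extended plane are handled through homogeneous coordinates,
    where infinity needs no separate treatment: the chordal distance is the
    sine of the angle between two complex lines. *)
Definition homog z : R[i] * R[i] := if z is Some z then (z, 1) else (1, 0).
Definition wedge p q : R[i] := p.1 * q.2 - p.2 * q.1.
Definition hnorm p : R := Num.sqrt (normc p.1 ^+ 2 + normc p.2 ^+ 2).
Definition proj_dist p q : R := normc (wedge p q) / (hnorm p * hnorm q).

Lemma hnorm_ge0 p : 0 <= hnorm p. Proof. exact: sqrtr_ge0. Qed.

Lemma sqr_hnorm p : hnorm p ^+ 2 = normc p.1 ^+ 2 + normc p.2 ^+ 2.
Proof. by rewrite sqr_sqrtr// addr_ge0// sqr_ge0. Qed.

Lemma hnorm_eq0 p : hnorm p = 0 -> p = (0, 0).
Proof.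
move=> p0; have := sqr_hnorm p; rewrite p0 expr0n/= => /esym/eqP.
rewrite paddr_eq0 ?sqr_ge0// !sqrf_eq0 => /andP[/eqP a /eqP b].
by case: p a b {p0} => a b /= /eq0_normc -> /eq0_normc ->.
Qed.

Lemma hnorm_gt0 p : p != (0, 0) -> 0 < hnorm p.
Proof.
by move=> p0; rewrite lt0r hnorm_ge0 andbT; apply: contra p0 => /eqP/hnorm_eq0 ->.
Qed.

Lemma homog_neq0 z : homog z != (0, 0).
Proof. by case: z => [z|]; rewrite xpair_eqE oner_eq0 ?andbF. Qed.

Lemma chordalE z w : chordal z w = proj_dist (homog z) (homog w).
Proof.
rewrite /proj_dist /wedge /hnorm.
case: z w => [z|] [w|] /=.
- rewrite !normc1 expr1n mulr1 mul1r ![1 + _]addrC mulrC [RHS]mulrC.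
  by rewrite [X in X^-1 * _ = _]mulrC.
- rewrite mulr0 mul1r sub0r normc_opp !normc0 !normc1 expr0n expr1n/= addr0 sqrtr1.
  by rewrite mulr1 mul1r [1 + _]addrC.
- rewrite mul1r mul0r subr0 !normc0 !normc1 expr0n expr1n/= addr0 sqrtr1.
  by rewrite !mul1r [1 + _]addrC.
- by rewrite mulr0 mul0r subr0 normc0 mul0r.
Qed.

Lemma hnorm_scale (c : R[i]) p : hnorm (c * p.1, c * p.2) = normc c * hnorm p.
Proof.
rewrite /hnorm /= !normcM !exprMn -mulrDr sqrtrM ?sqr_ge0// sqrtr_sqr.
by rewrite ger0_norm// normc_ge0.
Qed.

Lemma proj_dist_scale (c : R[i]) p q : c != 0 ->
  proj_dist (c * p.1, c * p.2) q = proj_dist p q.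
Proof.
move=> c0; rewrite /proj_dist hnorm_scale /wedge /=.
have nc0 : normc c != 0 by apply: contra c0 => /eqP/eq0_normc ->.
have -> : c * p.1 * q.2 - c * p.2 * q.1 = c * (p.1 * q.2 - p.2 * q.1) by ring.
by rewrite normcM !invfM -[_^-1 / _ / _]mulrA mulrACA divff// mul1r.
Qed.

Lemma proj_distC p q : proj_dist p q = proj_dist q p.
Proof.
rewrite /proj_dist mulrC [hnorm q * _]mulrC [LHS]mulrC /wedge normcB.
by do 3!f_equal; ring.
Qed.

Lemma proj_dist_ge0 p q : 0 <= proj_dist p q.
Proof. by rewrite divr_ge0 ?normc_ge0 ?mulr_ge0 ?hnorm_ge0. Qed.

Lemma Chat_div_scale (a b : R[i]) : (a, b) != (0, 0) ->
  exists2 c : R[i], c != 0 &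
    (a, b) = (c * (homog (Chat_div a b)).1, c * (homog (Chat_div a b)).2).
Proof.
rewrite xpair_eqE /Chat_div; have [->|b0 _] := eqVneq b 0; last first.
  by exists b => //=; rewrite mulrC divfK// mulr1.
by rewrite andbT => a0; exists a => //=; rewrite mulr1 mulr0.
Qed.

Lemma chordal_Chat_div (a b a' b' : R[i]) :
  (a, b) != (0, 0) -> (a', b') != (0, 0) ->
  chordal (Chat_div a b) (Chat_div a' b') = proj_dist (a, b) (a', b').
Proof.
move=> /Chat_div_scale[c c0 ->] /Chat_div_scale[c' c'0 ->].
by rewrite proj_dist_scale// proj_distC proj_dist_scale// chordalE proj_distC.
Qed.

(** In the pairing with the vector orthogonal to f, the Pluecker relation reads
    (p ^ q) |f|^2 = (p ^ f) <q, f> - (q ^ f) <p, f>; Cauchy-Schwarz bounds the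
    two inner products. *)
Lemma proj_dist_triangle p q f :
  p != (0, 0) -> q != (0, 0) -> f != (0, 0) ->
  proj_dist p q <= proj_dist p f + proj_dist q f.
Proof.
move=> /hnorm_gt0 p0 /hnorm_gt0 q0 /hnorm_gt0 f0.
pose dot u v : R[i] := u.1 * (v.1^*)%C + u.2 * (v.2^*)%C.
have dot_le u v : normc (dot u v) <= hnorm u * hnorm v.
  have conjN (x : R[i]) : normc (x^*)%C = normc x.
    by case: x => a b; rewrite /normc /= sqrrN.
  rewrite (le_trans (le_normcD _ _))// !normcM !conjN.
  rewrite -(@ler_pXn2r _ 2) ?nnegrE ?addr_ge0 ?mulr_ge0 ?normc_ge0 ?hnorm_ge0//.
  rewrite exprMn !sqr_hnorm -subr_ge0.
  rewrite (_ : _ - _ = (normc u.1 * normc v.2 - normc u.2 * normc v.1) ^+ 2).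
    by rewrite sqr_ge0.
  by ring.
have id : wedge p q * ((hnorm f ^+ 2)%:C)%C = wedge p f * dot q f - wedge q f * dot p f.
  by rewrite sqr_hnorm rmorphD /= -!mulc_conj /wedge /dot; ring.
have : normc (wedge p q) * hnorm f ^+ 2 <=
    normc (wedge p f) * (hnorm q * hnorm f) + normc (wedge q f) * (hnorm p * hnorm f).
  rewrite -[X in _ * X <= _]ger0_norm ?sqr_ge0// -normc_real -normcM id.
  rewrite (le_trans (le_normcD _ _))// normc_opp !normcM.
  by rewrite lerD// ler_wpM2l ?normc_ge0 ?dot_le.
rewrite /proj_dist.
have -> : normc (wedge p f) / (hnorm p * hnorm f) +
    normc (wedge q f) / (hnorm q * hnorm f)
  = (normc (wedge p f) * (hnorm q * hnorm f) + normc (wedge q f) * (hnorm p * hnorm f))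
     / hnorm f ^+ 2 / (hnorm p * hnorm q).
  by field; rewrite ?gt_eqF.
by move=> h; rewrite ler_pM2r ?invr_gt0 ?mulr_gt0// ler_pdivlMr ?exprn_gt0.
Qed.

Section Expansion.
Variables (alpha : nat -> R[i]) (n : nat) (C : R).
Let b : nat -> R[i] := fun=> 1.

(** S_n in homogeneous coordinates. *)
Definition cf_lin p : R[i] * R[i] :=
  (cf_num' alpha b n * p.1 + cf_num alpha b n * p.2,
   cf_den' alpha b n * p.1 + cf_den alpha b n * p.2).

Lemma cf_S_lin z :
  cf_S alpha b n z = Chat_div (cf_lin (homog z)).1 (cf_lin (homog z)).2.
Proof.
case: z => [z|] /=; last by rewrite !mulr1 !mulr0 !addr0.
by congr Chat_div; rewrite /= mulr1 [in RHS]mulrC addrC.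
Qed.

Hypothesis alpha1 : forall k, normc (alpha k) = 1.

Lemma wedge_cf_lin p q : normc (wedge (cf_lin p) (cf_lin q)) = normc (wedge p q).
Proof.
rewrite -[RHS]mul1r -[in RHS](cf_det_norm n alpha1) -normcM -normc_opp.
by congr normc; rewrite /wedge /=; ring.
Qed.

Lemma cf_lin_neq0 z : cf_lin (homog z) != (0, 0).
Proof.
apply/eqP => z0; have : exists w, wedge (homog z) (homog w) != 0.
  case: z z0 => [z|] _; last first.
    by exists (Some 0); rewrite /wedge /= mulr1 mul0r subr0 oner_eq0.
  by exists None; rewrite /wedge /= mulr0 mulr1 sub0r oppr_eq0 oner_eq0.
move=> [w /negP]; apply; apply/eqP/eq0_normc.
have w0 p : wedge (0, 0) p = 0 by rewrite /wedge !mul0r subr0.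
by rewrite -(wedge_cf_lin (homog z)) z0 w0 normc0.
Qed.

Lemma hnorm_cf_lin p : cf_bounded alpha n C ->
  hnorm (cf_lin p) <= 2 * C * hnorm p.
Proof.
case=> Bn Bn' Bd Bd'.
have C0 : 0 <= C by apply: le_trans Bn; apply: normc_ge0.
rewrite -(@ler_pXn2r _ 2) ?nnegrE ?mulr_ge0 ?hnorm_ge0//.
rewrite exprMn !sqr_hnorm /=.
set x := normc p.1; set y := normc p.2.
have x0 : 0 <= x := normc_ge0 _.
have y0 : 0 <= y := normc_ge0 _.
have bd (u v : R[i]) : normc u <= C -> normc v <= C ->
    normc (u * p.1 + v * p.2) ^+ 2 <= 2 * C ^+ 2 * (x ^+ 2 + y ^+ 2).
  move=> uC vC; have : normc (u * p.1 + v * p.2) <= C * (x + y).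
    by rewrite (le_trans (le_normcD _ _))// !normcM mulrDr lerD// ler_wpM2r.
  move=> h; apply: (@le_trans _ _ ((C * (x + y)) ^+ 2)).
    by rewrite ler_pXn2r ?nnegrE ?mulr_ge0 ?addr_ge0 ?normc_ge0.
  rewrite -subr_ge0 (_ : _ - _ = C ^+ 2 * (x - y) ^+ 2); last by ring.
  by rewrite mulr_ge0 ?sqr_ge0.
apply: (le_trans (lerD (bd _ _ Bn' Bn) (bd _ _ Bd' Bd))).
by rewrite le_eqVlt; apply/orP; left; apply/eqP; ring.
Qed.

(** The wedge product is multiplied by the determinant, of modulus 1, while the
    norms of both vectors are multiplied by at most 2 C. *)
Lemma chordal_cf_S z w : 0 < C -> cf_bounded alpha n C ->
  chordal z w <= (2 * C) ^+ 2 * chordal (cf_S alpha b n z) (cf_S alpha b n w).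
Proof.
move=> C0 bC; rewrite !cf_S_lin.
have E u : cf_lin u = ((cf_lin u).1, (cf_lin u).2) by [].
rewrite chordal_Chat_div -?E ?cf_lin_neq0// chordalE /proj_dist wedge_cf_lin.
have z0 := hnorm_gt0 (homog_neq0 z); have w0 := hnorm_gt0 (homog_neq0 w).
have lz0 := hnorm_gt0 (cf_lin_neq0 z); have lw0 := hnorm_gt0 (cf_lin_neq0 w).
have lz := hnorm_cf_lin (homog z) bC; have lw := hnorm_cf_lin (homog w) bC.
rewrite ler_pdivrMr ?mulr_gt0// [(2 * C) ^+ 2 * _]mulrA mulrAC.
rewrite ler_pdivlMr ?mulr_gt0//.
rewrite [X in _ <= X * _]mulrC -[leRHS]mulrA ler_wpM2l ?normc_ge0//.
rewrite (le_trans (ler_pM (ltW lz0) (ltW lw0) lz lw))//.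
by rewrite le_eqVlt; apply/orP; left; apply/eqP; ring.
Qed.

End Expansion.

(** If S_n v_n and S_n w_n have a common limit, their chordal distance tends to
    0; at the indices where the matrix is bounded the same follows for v_n and
    w_n themselves, against the positive lower limit. *)
Lemma not_cvg_generally (alpha : nat -> R[i]) (C : R) : 0 < C ->
  (forall k, normc (alpha k) = 1) ->
  (forall N, exists2 n, (N <= n)%N & cf_bounded alpha n C) ->
  ~ cf_converges_generally alpha (fun=> 1).
Proof.
move=> C0 a1 inf_bounded [f [v [w [sep Sv Sw]]]].
move: sep; apply/negP; rewrite -leNgt.
have small (e : R) : 0 < e -> \forall n \near \oo, cf_bounded alpha n C ->
    chordal (v n) (w n) <= e.
  move=> e0; pose e' := e / (2 * C) ^+ 2 / 2.
  have e'0 : 0 < e'.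
    by rewrite divr_gt0// divr_gt0// exprn_gt0// mulr_gt0.
  have Bv : \forall n \near \oo, chordal (cf_S alpha (fun=> 1) n (v n)) f < e'.
    exact: cvgr_lt Sv _ e'0.
  have Bw : \forall n \near \oo, chordal (cf_S alpha (fun=> 1) n (w n)) f < e'.
    exact: cvgr_lt Sw _ e'0.
  apply: filterS2 Bv Bw => n hv hw bn.
  apply: (le_trans (chordal_cf_S a1 (v n) (w n) C0 bn)).
  rewrite mulrC -ler_pdivlMr ?exprn_gt0 ?mulr_gt0//.
  rewrite chordalE; apply: (le_trans (proj_dist_triangle _ _ (homog_neq0 f))).
  - exact: homog_neq0.
  - exact: homog_neq0.
  rewrite -!chordalE; rewrite /e' in hv hw; lra.
rewrite limn_einf_lim; apply: lime_le; first exact: is_cvg_einfs.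
apply: nearW => N; apply/lee_addgt0Pr => e e0; rewrite add0e.
have [M _ hM] := small _ e0.
have [n nNM bn] := inf_bounded (maxn N M).
apply: (@le_trans _ _ (chordal (v n) (w n))%:E).
  apply: ereal_inf_lbound; exists n => //=; move: nNM; rewrite geq_max => /andP[]//.
rewrite lee_fin; apply: hM => //=.
by move: nNM; rewrite geq_max => /andP[].
Qed.

End Chordal.

(** * Roots of unity and the golden ratio *)

Section Exponential.
Variable R : realType.
Implicit Types (s t u v : R) (n c d : nat).

Lemma expiD s t : expi (s + t) = expi s * expi t.
Proof.
by rewrite /expi sinD cosD; apply/eqP; rewrite eq_complex /=; apply/andP; split;
  apply/eqP; ring.
Qed.

Lemma normc_expi t : normc (expi t) = 1.
Proof. by rewrite /normc /= cos2Dsin2 sqrtr1. Qed.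

Lemma exp2piiD s t : exp2pii (s + t) = exp2pii s * exp2pii t.
Proof. by rewrite /exp2pii mulrDr expiD. Qed.

Lemma exp2pii0 : exp2pii 0 = 1 :> R[i].
Proof. by rewrite /exp2pii mulr0 /expi cos0 sin0. Qed.

Lemma exp2pii1 : exp2pii 1 = 1 :> R[i].
Proof.
by rewrite /exp2pii mulr1 mulrC -[2]/(1 *+ 2) mulrnAr mulr1 /expi cos2pi sin2pi.
Qed.

Lemma exp2piiX t n : exp2pii (n%:R * t) = exp2pii t ^+ n.
Proof.
elim: n => [|n IH]; first by rewrite mul0r exp2pii0.
by rewrite -natr1 mulrDl mul1r exp2piiD IH exprSr.
Qed.

Lemma exp2pii_nat n : exp2pii n%:R = 1 :> R[i].
Proof. by rewrite -[n%:R]mulr1 exp2piiX exp2pii1 expr1n. Qed.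

Lemma exp2pii_neq1 t : 0 < t < 1 -> exp2pii t != 1.
Proof.
move=> /andP[t0 t1]; apply/eqP => /(congr1 (@complex.Re R)) /=.
have -> : 2 * pi * t = (pi * t) *+ 2 by rewrite mulr2n; ring.
rewrite cos_mulr2n => h.
have : 0 < sin (pi * t).
  by apply: sin_gt0_pi; rewrite mulr_gt0 ?pi_gt0//= gtr_pMr ?pi_gt0.
have := cos2Dsin2 (pi * t); move: h; rewrite mulr2n; nra.
Qed.

Lemma exp2pii_inj s t : 0 <= s < 1 -> 0 <= t < 1 ->
  exp2pii s = exp2pii t -> s = t.
Proof.
wlog st : s t / s <= t => [wl|].
  by case: (leP s t) => [/wl//|/ltW /wl h ? ? e]; apply/esym/h.
move=> /andP[s0 s1] /andP[t0 t1] e; apply/eqP; rewrite eq_le st /= leNgt.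
apply/negP => ts; have : exp2pii (t - s) != 1 by apply: exp2pii_neq1; lra.
have : exp2pii s * exp2pii (t - s) = exp2pii s * 1.
  by rewrite -exp2piiD mulr1 e; congr exp2pii; ring.
move/mulfI => -> //; first by rewrite eqxx.
by apply/eqP => /(congr1 (@normc R)); rewrite normc_expi normc0; apply/eqP/oner_neq0.
Qed.

Lemma exp2pii_primitive c d : (0 < d)%N -> coprime c d ->
  d.-primitive_root (exp2pii (c%:R / d%:R) : R[i]).
Proof.
move=> d0 cd; set x := exp2pii _; have dR : d%:R != 0 :> R by rewrite pnatr_eq0 -lt0n.
have xd : x ^+ d = 1 by rewrite -exp2piiX mulrC divfK// exp2pii_nat.
have [m pm md] := prim_order_exists d0 xd.
suff -> : d = m by [].
apply/eqP; rewrite eqn_dvd md andbT.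
have := prim_expr_order pm; rewrite -exp2piiX mulrA -natrM.
rewrite {1}(divn_eq (m * c) d) natrD natrM mulrDl mulfK// exp2piiD exp2pii_nat mul1r.
have [r0 _|r0] := posnP ((m * c) %% d)%N.
  by rewrite coprime_sym in cd; rewrite -(Gauss_dvdl m cd) /dvdn r0.
move/eqP; apply: contraTT => _; apply: exp2pii_neq1.
by rewrite divr_gt0 ?ltr0n//= ltr_pdivrMr ?ltr0n// mul1r ltr_nat ltn_mod.
Qed.

Lemma sin_le_abs t : `|sin t| <= `|t|.
Proof.
wlog t0 : t / 0 < t => [wl|].
  have [t0|t0|->] := ltgtP t 0; [|exact: wl|by rewrite sin0].
  by have := wl (- t); rewrite sinN !normrN; apply; rewrite oppr_gt0.
have dsin (x : R) : x \in `]0, t[ -> is_derive x 1 sin (cos x).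
  by move=> _; exact: is_derive_sin.
have csin : {within `[0, t], continuous (@sin R)}.
  by apply: continuous_subspaceT => x; exact: continuous_sin.
have [c _ ] := MVT t0 dsin csin; rewrite sin0 !subr0 => ->.
by rewrite normrM ler_piMl// cos_max.
Qed.

(** The chord has length 2 |sin h|, where 2 h is the difference of the angles. *)
Lemma expi_lipschitz s t : normc (expi s - expi t) <= `|s - t|.
Proof.
pose m := (s + t) / 2; pose h := (s - t) / 2.
have -> : s = m + h by rewrite /m /h; field.
have -> : t = m - h by rewrite /m /h; field.
have -> : m + h - (m - h) = 2 * h by ring.
rewrite /expi -(@ler_pXn2r _ 2) ?nnegrE ?normc_ge0//.
rewrite real_normK ?num_real// /normc sqr_sqrtr ?addr_ge0 ?sqr_ge0//=.
rewrite cosD cosB sinD sinB.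
have : sin h ^+ 2 <= h ^+ 2.
  rewrite -(real_normK (num_real (sin h))) -(real_normK (num_real h)).
  by rewrite ler_pXn2r ?nnegrE// sin_le_abs.
have := cos2Dsin2 m.
set cm := cos m; set sm := sin m; set ch := cos h; set sh := sin h.
move=> m1 hh.
have -> : (cm * ch - sm * sh - (cm * ch + sm * sh)) ^+ 2 +
  (sm * ch + cm * sh - (sm * ch - cm * sh)) ^+ 2 =
  4 * sh ^+ 2 * (cm ^+ 2 + sm ^+ 2) by ring.
rewrite m1; lra.
Qed.

Lemma exp2pii_lipschitz s t : normc (exp2pii s - exp2pii t) <= 2 * pi * `|s - t|.
Proof.
rewrite /exp2pii (le_trans (expi_lipschitz _ _))// -mulrBr normrM.
by rewrite [X in X * _]ger0_norm// mulr_ge0 ?pi_ge0.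
Qed.

Lemma golden_sqr : golden R ^+ 2 = golden R + 1.
Proof.
have := @sqr_sqrtr R 5 (ler0n _ _); rewrite /golden; set s := Num.sqrt _ => s2.
have -> : ((s + 1) / 2) ^+ 2 = (s ^+ 2 + 2 * s + 1) / 4 by field.
by rewrite s2; field.
Qed.

Lemma golden_gt1 : 1 < golden R.
Proof.
have := golden_sqr; have : 0 < golden R.
  by rewrite /golden divr_gt0// ltr_wpDl ?sqrtr_ge0.
nra.
Qed.

Lemma golden_lt2 : golden R < 2.
Proof. have := golden_sqr; have := golden_gt1; nra. Qed.

End Exponential.

(** * Dependence of the approximants on the variable *)

Section Perturbation.
Variable R : realType.
Local Notation phi := (golden R).

(** All values are dominated by the Fibonacci recurrence, hence by powers of
    phi. The k-th step introduces an error of at most k delta phi^k, which then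
    propagates by the same recurrence; summing over k yields the factor n^2. *)
Lemma cf_rec_perturb (alpha beta : nat -> R[i]) (delta : R) (p q : R[i]) n :
  0 <= delta ->
  (forall k, normc (alpha k) <= 1) -> (forall k, normc (beta k) <= 1) ->
  (forall k, normc (alpha k - beta k) <= k%:R * delta) ->
  normc p <= 1 -> normc q <= 1 ->
  let u := cf_rec alpha (fun=> 1) p q n in
  let v := cf_rec beta (fun=> 1) p q n in
  [/\ normc v.1 <= phi ^+ n, normc v.2 <= phi ^+ n.+1,
      normc (u.1 - v.1) <= n%:R ^+ 2 * phi ^+ n * delta &
      normc (u.2 - v.2) <= n%:R ^+ 2 * phi ^+ n.+1 * delta].
Proof.
move=> delta0 a1 b1 ab p1 q1; have phi1 : 1 < phi := golden_gt1 R.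
have phiS k : phi ^+ k.+2 = phi ^+ k.+1 + phi ^+ k.
  by rewrite !exprS mulrA -expr2 golden_sqr; ring.
have phi_ge0 k : 0 <= phi ^+ k by rewrite exprn_ge0//; lra.
elim: n => [|n].
  rewrite /= !subrr normc0 expr0 expr1 p1 expr0n /= !mul0r lexx.
  by split => //; apply: (le_trans q1); apply: ltW.
rewrite [cf_rec alpha _ _ _ n.+1]/= [cf_rec beta _ _ _ n.+1]/=.
case: (cf_rec alpha _ _ _ n) => u u'; case: (cf_rec beta _ _ _ n) => v v'.
rewrite /= !mul1r => -[vn vn' uv uv'].
have nn : n.+1%:R = n%:R + 1 :> R by rewrite -natr1.
have n0 : 0 <= n%:R :> R by [].
have P0 := phi_ge0 n; have P1 := phi_ge0 n.+1.
split=> //.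
- rewrite phiS (le_trans (le_normcD _ _))// lerD// normcM.
  by rewrite (le_trans _ vn)// ler_piMl ?normc_ge0.
- rewrite (le_trans uv')// ler_wpM2r// ler_wpM2r// nn; nra.
- have step (a b c c' w w' : R[i]) : c' + a * c - (w' + b * w) =
    (c' - w') + (a * (c - w) + (a - b) * w) by ring.
  rewrite step (le_trans (le_normcD _ _))//.
  apply: (@le_trans _ _ (n%:R ^+ 2 * phi ^+ n.+1 * delta +
     (n%:R ^+ 2 * phi ^+ n * delta + (n.+1%:R * delta) * phi ^+ n))).
    rewrite lerD// (le_trans (le_normcD _ _))// !normcM lerD//.
      by rewrite (le_trans _ uv)// ler_piMl ?normc_ge0.
    by rewrite ler_pM ?normc_ge0.
  rewrite -subr_ge0 phiS nn.
  have -> : (n%:R + 1) ^+ 2 * (phi ^+ n.+1 + phi ^+ n) * delta -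
    (n%:R ^+ 2 * phi ^+ n.+1 * delta +
    (n%:R ^+ 2 * phi ^+ n * delta + (n%:R + 1) * delta * phi ^+ n)) =
    ((2 * n%:R + 1) * phi ^+ n.+1 + n%:R * phi ^+ n) * delta by ring.
  by rewrite mulr_ge0// addr_ge0// mulr_ge0// addr_ge0// mulr_ge0.
Qed.

Lemma normc_expB (x y : R[i]) k : normc x = 1 -> normc y = 1 ->
  normc (x ^+ k - y ^+ k) <= k%:R * normc (x - y).
Proof.
move=> x1 y1; elim: k => [|k IH]; first by rewrite !expr0 subrr normc0 mul0r.
have -> : x ^+ k.+1 - y ^+ k.+1 = x * (x ^+ k - y ^+ k) + (x - y) * y ^+ k.
  by rewrite !exprS; ring.
rewrite (le_trans (le_normcD _ _))// !normcM normcX x1 y1 expr1n mul1r mulr1.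
by rewrite -natr1 mulrDl mul1r lerD.
Qed.

Lemma cf_bounded_perturb (x y : R[i]) (n : nat) (C e : R) :
  normc x = 1 -> normc y = 1 ->
  n%:R ^+ 2 * phi ^+ n.+1 * normc (y - x) <= e ->
  cf_bounded (fun k => x ^+ k) n C -> cf_bounded (fun k => y ^+ k) n (C + e).
Proof.
move=> x1 y1 small; have phi1 : 1 < phi := golden_gt1 R.
have X1 k : normc (x ^+ k) <= 1 by rewrite normcX x1 expr1n.
have Y1 k : normc (y ^+ k) <= 1 by rewrite normcX y1 expr1n.
have XY k := normc_expB k y1 x1.
have d0 := normc_ge0 (y - x).
have n01 : normc (0 : R[i]) <= 1 by rewrite normc0.
have n11 : normc (1 : R[i]) <= 1 by rewrite normc1.
have [_ _ A1 A2] := cf_rec_perturb n d0 Y1 X1 XY n11 n11.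
have [_ _ B1 B2] := cf_rec_perturb n d0 Y1 X1 XY n01 n11.
have le1 : n%:R ^+ 2 * phi ^+ n * normc (y - x) <= e.
  apply: le_trans small; rewrite ler_wpM2r// ler_wpM2l ?sqr_ge0//.
  by rewrite ler_eXn2l// leqnSn.
have tri (u v : R[i]) : normc (u - v) <= e -> normc v <= C -> normc u <= C + e.
  move=> uv vC; rewrite -[u](subrK v) (le_trans (le_normcD _ _))// addrC lerD//.
move=> [a a' b b']; split.
- exact: tri (le_trans A2 small) a.
- exact: tri (le_trans A1 le1) a'.
- exact: tri (le_trans B2 small) b.
- exact: tri (le_trans B1 le1) b'.
Qed.

End Perturbation.

(** * Regular continued fractions *)

Section RegularFraction.
Variable R : realType.

Definition conv_num' (t : R) (n : nat) : nat :=
  cf_num' (fun=> 1%N) (partial_quotient t) n.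
Definition conv_den' (t : R) (n : nat) : nat :=
  cf_den' (fun=> 1%N) (partial_quotient t) n.
Definition conv_err (t : R) (n : nat) : R :=
  (conv_den t n)%:R * t - (conv_num t n)%:R.
Definition conv_err' (t : R) (n : nat) : R :=
  (conv_den' t n)%:R * t - (conv_num' t n)%:R.

Variable t : R.
Hypotheses (t_gt0 : 0 < t) (t_irr : irrational t).

Local Notation xi := (complete_quotient t).
Local Notation a := (partial_quotient t).
Local Notation c := (conv_num t).
Local Notation d := (conv_den t).
Local Notation c' := (conv_num' t).
Local Notation d' := (conv_den' t).
Local Notation err := (conv_err t).
Local Notation err' := (conv_err' t).

Lemma complete_quotient_irr n : 0 < xi n /\ irrational (xi n).
Proof.
elim: n => [|n [x0 xirr]] //=.
set x := xi n in x0 xirr *; set k := Num.truncn x.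
have kx : k%:R <= x by rewrite truncn_le// ltW.
have kx' : k%:R != x.
  by apply/eqP => kx'; apply: xirr; exists k%:R => //; rewrite ratr_nat.
split; first by rewrite invr_gt0 subr_gt0 lt_neqAle kx' kx.
move=> [q _ qx]; apply: xirr; exists (q^-1 + k%:R) => //.
by rewrite rmorphD fmorphV /= ratr_nat qx invrK subrK.
Qed.

Lemma complete_quotient_bounds n : (a n)%:R < xi n < (a n)%:R + 1.
Proof.
have [x0 xirr] := complete_quotient_irr n.
have := truncn_itv (ltW x0); rewrite -/(a n) -natr1 => /andP[ax ->].
rewrite andbT lt_neqAle ax andbT; apply/eqP => kx.
by apply: xirr; exists (a n)%:R => //; rewrite ratr_nat.
Qed.

Lemma complete_quotientS n : xi n.+1 * (xi n - (a n)%:R) = 1.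
Proof.
rewrite /= mulVf// subr_eq0 gt_eqF//.
by have /andP[] := complete_quotient_bounds n.
Qed.

Lemma complete_quotientS_gt1 n : 1 < xi n.+1.
Proof.
have := complete_quotientS n; have := complete_quotient_bounds n.
have [] := complete_quotient_irr n.+1; nra.
Qed.

Lemma partial_quotientS_gt0 n : (0 < a n.+1)%N.
Proof.
have /andP[_] := complete_quotient_bounds n.+1.
have := complete_quotientS_gt1 n; rewrite -(ltr_nat R); lra.
Qed.

Lemma conv_rec n : [/\ c n.+1 = (a n.+1 * c n + c' n)%N,
  d n.+1 = (a n.+1 * d n + d' n)%N, c' n.+1 = c n & d' n.+1 = d n].
Proof.
rewrite /conv_num' /conv_den' /conv_num /conv_den /cf_num /cf_den /cf_num' /cf_den' /=.
case: (cf_rec _ _ _ _ n) => p p'; case: (cf_rec _ _ _ _ n) => q q' /=.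
by rewrite !mul1r.
Qed.

Lemma conv_den'_le n : (d' n <= d n)%N /\ (0 < d n)%N.
Proof.
elim: n => [|n [le0 gt0]] //; have [_ -> _ ->] := conv_rec n.
by have := partial_quotientS_gt0 n; nia.
Qed.

Lemma conv_den_gt0 n : (0 < d n)%N. Proof. by case: (conv_den'_le n). Qed.

Lemma conv_den_leS n : (d n <= d n.+1)%N.
Proof. by have [_ _ _ <-] := conv_rec n; case: (conv_den'_le n.+1). Qed.

Lemma conv_den_homo m n : (m <= n)%N -> (d m <= d n)%N.
Proof. by apply: (homo_leq (leqnn) leq_trans conv_den_leS). Qed.

Lemma conv_den_ge n : (n <= d n)%N.
Proof.
elim: n => [|[|n] IH] //; first exact: conv_den_gt0.
have [_ -> _ _] := conv_rec n.+1; have [_ _ _ ->] := conv_rec n.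
by have := conv_den_gt0 n; have := partial_quotientS_gt0 n.+1; nia.
Qed.

(** This is the identity t = (c_n xi + c_{n-1}) / (d_n xi + d_{n-1}), where
    xi is the complete quotient of index n + 1, cleared of denominators. *)
Lemma conv_err_quotient n : err n * xi n.+1 = - err' n.
Proof.
elim: n => [|n IH].
  rewrite /conv_err /conv_err' /conv_den' /conv_num' /conv_num /conv_den.
  rewrite /cf_num /cf_den /cf_num' /cf_den' /=.
  by have := complete_quotientS 0; rewrite mulrC /= mul1r mul0r sub0r opprK => ->.
have [cE dE c'E d'E] := conv_rec n.
have E : err n.+1 = (a n.+1)%:R * err n + err' n.
  by rewrite /conv_err /conv_err' cE dE !natrD !natrM; ring.
have E' : err' n.+1 = err n by rewrite /conv_err' c'E d'E.
rewrite E E' -[err' n]opprK -IH.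
have -> : (a n.+1)%:R * err n - err n * xi n.+1 =
    - (err n * (xi n.+1 - (a n.+1)%:R)) by ring.
by rewrite mulNr -mulrA [_ * xi n.+2]mulrC complete_quotientS mulr1.
Qed.

(** The combination of the errors cancels t and leaves the determinant of two
    consecutive convergents. *)
Lemma conv_err_det n : `|(d n)%:R * err' n - (d' n)%:R * err n| = 1.
Proof.
elim: n => [|n IH].
  rewrite /conv_err /conv_err' /conv_den' /conv_num' /conv_num /conv_den.
  rewrite /cf_num /cf_den /cf_num' /cf_den' /=.
  by rewrite !mul0r sub0r subr0 mul1r normrN normr1.
have [cE dE c'E d'E] := conv_rec n.
rewrite -[RHS]IH -[LHS]normrN; congr (`|_|).
by rewrite /conv_err /conv_err' cE dE c'E d'E !natrD !natrM; ring.
Qed.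

(** The exact size of the error. As xi lies between a_{n+1} and a_{n+1} + 1, it
    turns information on the error into information on the next partial
    quotient, and conversely. *)
Lemma conv_err_norm n : `|err n| * ((d n)%:R * xi n.+1 + (d' n)%:R) = 1.
Proof.
have x0 : 0 < xi n.+1 by have [] := complete_quotient_irr n.+1.
have nn : 0 <= (d n)%:R * xi n.+1 + (d' n)%:R.
  by rewrite addr_ge0// mulr_ge0// ltW.
rewrite -[RHS](conv_err_det n) -[X in _ * X = _](ger0_norm nn).
rewrite -normrM -[RHS]normrN; congr (`|_|).
have -> : err' n = - (err n * xi n.+1) by rewrite conv_err_quotient opprK.
ring.
Qed.

Lemma conv_approx_le n :
  `|t - (c n)%:R / (d n)%:R| <= ((d n)%:R ^+ 2 * (a n.+1)%:R)^-1.
Proof.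
have d0 : 0 < (d n)%:R :> R by rewrite ltr0n conv_den_gt0.
have a0 : 0 < (a n.+1)%:R :> R by rewrite ltr0n partial_quotientS_gt0.
have -> : t - (c n)%:R / (d n)%:R = err n / (d n)%:R.
  by rewrite /conv_err; field; rewrite gt_eqF.
rewrite normrM normfV [X in _ / X]gtr0_norm// -[leRHS]mul1r.
rewrite ler_pdivlMr ?mulr_gt0 ?exprn_gt0//.
have -> : `|err n| / (d n)%:R * ((d n)%:R ^+ 2 * (a n.+1)%:R) =
    `|err n| * ((d n)%:R * (a n.+1)%:R).
  by field; rewrite gt_eqF.
rewrite -[leRHS](conv_err_norm n) ler_wpM2l// ler_wpDr// ler_wpM2l// ltW//.
by have /andP[] := complete_quotient_bounds n.+1.
Qed.

Lemma partial_quotient_gt n (e : R) : 0 < e -> `|err n| < e ->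
  ((d n)%:R * e)^-1 < (a n.+1)%:R + 2.
Proof.
move=> e0 ne; have d0 : 0 < (d n)%:R :> R by rewrite ltr0n conv_den_gt0.
rewrite -[ltLHS]mul1r ltr_pdivrMr ?mulr_gt0// -[ltLHS](conv_err_norm n).
have dd : (d' n)%:R <= (d n)%:R :> R by rewrite ler_nat; case: (conv_den'_le n).
have /andP[_ xa] := complete_quotient_bounds n.+1.
have x0 : 0 < xi n.+1 by have [] := complete_quotient_irr n.+1.
apply: (@lt_le_trans _ _ (e * ((d n)%:R * xi n.+1 + (d' n)%:R))).
  by rewrite ltr_pM2r// ltr_pwDl// mulr_gt0.
rewrite (_ : (_ + 2) * _ = e * ((d n)%:R * ((a n.+1)%:R + 2))); last by ring.
rewrite ler_wpM2l ?ltW//; nra.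
Qed.

(** Legendre's criterion. Choose h with d_h <= q < d_{h+1}, and write (p, q) as
    an integral combination of the convergents of index h and h + 1. If the
    second coefficient W is not 0, the coefficients have opposite signs because
    q < d_{h+1}; as consecutive errors have opposite signs too, they add up, and
    |d_h t - c_h| <= |q t - p|. Then |W| = |p d_h - q c_h| is at most
    2 q |q t - p| < 1, a contradiction. So p / q = c_h / d_h, and both fractions
    are in lowest terms. *)
Lemma legendre_convergent (p q : nat) : (0 < q)%N -> coprime p q ->
  `|q%:R * t - p%:R| < (2 * q%:R)^-1 ->
  exists h, c h = p /\ d h = q.
Proof.
move=> q0 pq close.
have [h /andP[hq qh]] : exists h, (d h <= q < d h.+1)%N.
  have [n /andP[nq]] : exists n, (d 0 <= q)%N && ~~ (d n <= q)%N.
    exists q.+1; rewrite -ltnNge conv_den_ge andbT; exact: q0.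
  elim: n nq => [-> //|n IH] d0q nn.
  case: (leqP (d n) q) => [dn|dn]; last by apply: IH; rewrite // -ltnNge.
  by exists n; rewrite dn ltnNge.
exists h.
have qR : 0 < q%:R :> R by rewrite ltr0n.
have dR : 0 < (d h)%:R :> R by rewrite ltr0n conv_den_gt0.
have dq : (d h)%:R <= q%:R :> R by rewrite ler_nat.
pose e := q%:R * t - p%:R; rewrite -/e in close.
pose W : int := p%:Z * (d h)%:Z - q%:Z * (c h)%:Z.
have WE : W%:~R = q%:R * err h - (d h)%:R * e :> R.
  by rewrite /W rmorphB !rmorphM /= /conv_err /e; ring.
suff W0 : W = 0.
  have E : (p * d h = q * c h)%N.
    by apply/eqP; rewrite -eqz_nat !PoszM -subr_eq0 -/W W0.
  have dqE : d h = q.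
    apply/eqP; rewrite eqn_dvd; apply/andP; split.
      have dc : coprime (d h) (c h) by rewrite coprime_sym coprime_conv.
      by rewrite -(Gauss_dvdl q dc) -E dvdn_mull.
    have qp : coprime q p by rewrite coprime_sym.
    by rewrite -(Gauss_dvdr (d h) qp) E dvdn_mulr.
  by split=> //; apply/eqP; rewrite -(eqn_pmul2l q0) -E dqE mulnC.
have [//|W0] := eqVneq W 0; exfalso.
have W1 : 1 <= `|W%:~R| :> R.
  by rewrite -intr_norm -[1]/(1%:~R) ler_int; move: (W) W0 => w; clear; lia.
(* W and U are the coefficients of (p, q) up to the common sign D. *)
have errle : `|err h| <= `|e|.
  pose x := xi h.+2; have x1 : 1 < x := complete_quotientS_gt1 h.+1.
  have [_ _ c'E d'E] := conv_rec h.
  have errx : err h = - (err h.+1 * x).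
    by rewrite /x conv_err_quotient opprK /conv_err' c'E d'E.
  pose U : int := q%:Z * (c h.+1)%:Z - p%:Z * (d h.+1)%:Z.
  pose D : R := (d h.+1)%:R * err h - (d h)%:R * err h.+1.
  have D1 : `|D| = 1.
    by rewrite -[RHS](conv_err_det h.+1) /D /conv_err' c'E d'E.
  have De : D * e = err h.+1 * (W%:~R - U%:~R * x).
    have -> : err h.+1 * (W%:~R - U%:~R * x) = W%:~R * err h.+1 + U%:~R * err h.
      by rewrite errx; ring.
    by rewrite /W /U !rmorphB !rmorphM /= /D /conv_err /e; ring.
  have Dq : D * q%:R = U%:~R * (d h)%:R + W%:~R * (d h.+1)%:R.
    by rewrite /W /U !rmorphB !rmorphM /= /D /conv_err /e; ring.
  have zq : `|D * q%:R| < (d h.+1)%:R by rewrite normrM D1 mul1r normr_nat ltr_nat.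
  have -> : `|e| = `|D * e| by rewrite normrM D1 mul1r.
  rewrite De errx normrN !normrM ler_wpM2l// [X in X <= _]gtr0_norm; last by lra.
  move: zq; rewrite Dq ltr_norml => /andP[z1 z2].
  have [Wpos|Wneg] : (1 <= W) \/ (W <= -1) by move: (W) W0 => w; clear; lia.
    have W1' : 1 <= W%:~R :> R by rewrite -[1]/(1%:~R) ler_int.
    have : U%:~R < 0 :> R by nra.
    rewrite -[0]/(0%:~R) ltr_int => U0.
    have U1 : U%:~R <= -1 :> R.
      by rewrite -[-1]/((-1)%:~R) ler_int; move: (U) U0 => w; clear; lia.
    by apply: le_trans (ler_norm _); nra.
  have W1' : W%:~R <= -1 :> R by rewrite -[-1]/((-1)%:~R) ler_int.
  have : 0 < U%:~R :> R by nra.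
  rewrite -[0]/(0%:~R) ltr_int => U0.
  have U1 : 1 <= U%:~R :> R.
    by rewrite -[1]/(1%:~R) ler_int; move: (U) U0 => w; clear; lia.
  by rewrite -normrN; apply: le_trans (ler_norm _); nra.
have : `|W%:~R| < 1 :> R; last by rewrite ltNge W1.
rewrite WE (le_lt_trans (ler_normB _ _))// !normrM !normr_nat.
have e1 : 2 * q%:R * `|e| < 1 by rewrite mulrC -ltr_pdivlMr ?mulr_gt0// mul1r.
have := normr_ge0 e; nra.
Qed.

End RegularFraction.

(** * Divergence *)

Section Divergence.
Variable R : realType.
Variable t : R.
Hypotheses (t_gt0 : 0 < t) (t_irr : irrational t).
Hypothesis t_large : forall N, exists2 h, (N <= h)%N & large_partial_quotient t h.

(** The left factor bounds the distance from exp (2 pi i t) to the root of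
    unity. The factor d^2 comes from the quality of a convergent, the remaining
    ones from the partial quotient; powers of phi beyond phi^(2d) are dropped. *)
Lemma large_partial_quotient_error h : large_partial_quotient t h ->
  let d := conv_den t h in
  2 * pi * `|t - (conv_num t h)%:R / d%:R| *
    (d%:R ^+ 2 * golden R ^+ (2 * d) * (d.+1)%:R) <= 1.
Proof.
rewrite /large_partial_quotient; set d := conv_den t h => large /=.
have dN : (0 < d)%N := conv_den_gt0 t_gt0 t_irr h.
have d1 : 1 <= d%:R :> R by rewrite ler1n.
have phi1 := golden_gt1 R; have pi0 := pi_gt0 R.
have := conv_approx_le t_gt0 t_irr h; rewrite -/d.
set a : R := (partial_quotient t h.+1)%:R in large *; set E := `|_| => Ea.
set P := golden R ^+ (2 * d).
have P0 : 0 < P by rewrite exprn_gt0//; lra.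
have PP : P <= golden R ^+ (d ^ 2 + 2 * d) by rewrite ler_weXn2l ?leq_addl// ltW.
have aP : 2 * pi * P * d.+1%:R <= a.
  apply: le_trans (ltW large); rewrite -mulrA [P * _]mulrC mulrA.
  have D1 : 1 <= d.+1%:R :> R by rewrite ler1n.
  apply: ler_pM => //.
  - by rewrite !mulr_ge0 ?pi_ge0.
  - exact: ltW.
  - rewrite ler_wpM2l ?mulr_ge0 ?pi_ge0//; nra.
have a0 : 0 < a.
  by apply: lt_le_trans aP; rewrite !mulr_gt0.
have Ea' : E * d%:R ^+ 2 <= a^-1.
  by rewrite -ler_pdivlMr ?exprn_gt0 ?ltr0n// -invfM mulrC.
have -> : 2 * pi * E * (d%:R ^+ 2 * P * d.+1%:R) =
  (E * d%:R ^+ 2) * (2 * pi * P * d.+1%:R) by ring.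
have Ed0 : 0 <= E * d%:R ^+ 2 by rewrite mulr_ge0 ?sqr_ge0 ?normr_ge0.
rewrite (le_trans (ler_wpM2l Ed0 aP))//.
have an0 : a != 0 by rewrite gt_eqF.
by rewrite -[leRHS](mulVf an0) ler_wpM2r// ltW.
Qed.

(** After d - 1 steps the perturbation is at most (d - 1)^2 phi^d |y - x| <= 1,
    so the bound 2 at the root of unity becomes 3 at y. *)
Lemma rogers_ramanujan_not_cvg_generally :
  ~ cf_converges_generally (K_alpha (exp2pii t)) (@K_b R).
Proof.
apply: (@not_cvg_generally R (K_alpha (exp2pii t)) (2 + 1)) => [|k|N].
- by [].
- by rewrite /K_alpha normcX normc_expi expr1n.
have [h Nh large] := t_large N.+1.
have dN := conv_den_gt0 t_gt0 t_irr h; have dge := conv_den_ge t_gt0 t_irr h.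
exists (conv_den t h).-1; first by lia.
have prim := exp2pii_primitive R dN (coprime_conv t h).
have E := large_partial_quotient_error large.
set d := conv_den t h in dN dge prim E *.
apply: cf_bounded_perturb (primitive_cf_bounded prim _); try exact: normc_expi.
have phi1 := golden_gt1 R; have pi0 := pi_gt0 R.
have := exp2pii_lipschitz t ((conv_num t h)%:R / d%:R); rewrite -/d.
move: E; rewrite /= -/d; set e := `|_| => E lip.
have e0 : 0 <= e by rewrite normr_ge0.
rewrite prednK//; apply: le_trans E; rewrite mulrC ler_pM ?normc_ge0//.
  by rewrite mulr_ge0 ?sqr_ge0// exprn_ge0//; lra.
have P0 k : 1 <= golden R ^+ k by rewrite exprn_ege1// ltW.
rewrite mulnC; rewrite -[leRHS]mulrA ler_pM ?sqr_ge0//.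
- by rewrite (le_trans _ (P0 _)).
- by rewrite ler_pXn2r ?nnegrE// ler_nat leq_pred.
rewrite (@le_trans _ _ (golden R ^+ (d * 2)))//.
  by rewrite ler_weXn2l ?leq_pmulr// ltW.
by rewrite ler_peMr ?(le_trans _ (P0 _))// ler1n.
Qed.

End Divergence.

(** * Measure zero *)

Section NullSet.
Variable R : realType.
Local Notation mu := (@lebesgue_measure R).

Definition often_large (t : R) : Prop :=
  [/\ 0 < t < 1, irrational t &
      forall N, exists2 h, (N <= h)%N & large_partial_quotient t h].

Lemma Sdiamond_often_large (t : R) : Sdiamond t -> often_large t.
Proof.
move=> [t01 tirr [f [g [r [s [u [v [[f_incr _] _ _ large _]]]]]]]].
split=> // N; exists (f N); last by case: (large N).
by elim: N => // N IH; apply: leq_ltn_trans IH (f_incr _ _ (ltnSn N)).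
Qed.

(** The radius is chosen so that the d + 1 arcs of denominator d have total
    length at most 4 / 2^d; 2 <= phi^2 allows powers of 2 instead of phi. *)
Definition arc_radius (d : nat) : R := 2 * ((d.+1)%:R * 2 ^+ d)^-1.
Definition rational_arcs (d : nat) : set R :=
  \bigcup_(c in `I_d.+1) ball (2 * pi * (c%:R / d%:R) : R) (arc_radius d).

Lemma arc_radius_gt0 d : 0 < arc_radius d.
Proof. by rewrite /arc_radius mulr_gt0// invr_gt0 mulr_gt0// exprn_gt0. Qed.

Lemma rational_arcs_measurable d : measurable (rational_arcs d).
Proof. by apply: bigcup_measurable => c _; exact: measurable_realfun.measurable_ball. Qed.

Lemma rational_arcs_measure d : (mu (rational_arcs d) <= (4 * 2^-1 ^+ d)%:E)%E.
Proof.
have bound n : (mu (\bigcup_(c in `I_n)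
      ball (2 * pi * (c%:R / d%:R) : R)%R (arc_radius d)) <=
    (n%:R * (arc_radius d *+ 2))%:E)%E.
  elim: n => [|n IH]; first by rewrite II0 bigcup_set0 measure0 mul0r.
  rewrite IIS bigcup_setU bigcup_set1.
  rewrite (le_trans (measureU2 _ _ _))//.
  - by apply: bigcup_measurable => c _; exact: measurable_realfun.measurable_ball.
  - exact: measurable_realfun.measurable_ball.
  have -> : n.+1%:R * (arc_radius d *+ 2) =
      n%:R * (arc_radius d *+ 2) + arc_radius d *+ 2.
    by rewrite -[n.+1%:R]natr1 mulrDl mul1r.
  rewrite EFinD leeD//.
  by rewrite le_eqVlt; apply/orP; left; apply/eqP;
    exact: lebesgue_measure_ball (ltW (arc_radius_gt0 d)).
apply: (le_trans (bound _)); rewrite lee_fin /arc_radius exprVn.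
have d0 : d.+1%:R != 0 :> R by [].
have p0 : 2 ^+ d != 0 :> R by rewrite expf_neq0.
by rewrite -mulr_natr le_eqVlt; apply/orP; left; apply/eqP;
  move: (d.+1%:R) (2 ^+ d) d0 p0 => D P D0 P0; field; rewrite D0 P0.
Qed.

Lemma limsup_rational_arcs_null : mu (lim_sup_set rational_arcs) = 0.
Proof.
apply: lim_sup_set_cvg0 => [d|]; first exact: rational_arcs_measurable.
apply: (@le_lt_trans _ _ 8%:E); last exact: ltry.
apply: lime_le; first exact: is_cvg_nneseries.
apply: nearW => n; apply: (@le_trans _ _ (\sum_(0 <= d < n) (4 * 2^-1 ^+ d)%:E)%E).
  by apply: lee_sum => d _; exact: rational_arcs_measure.
rewrite sumEFin lee_fin.
have -> : \sum_(0 <= d < n) (4 * 2^-1 ^+ d) = 8 - 8 * 2^-1 ^+ n :> R.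
  elim: n => [|n IH]; first by rewrite big_geq// expr0 mulr1 subrr.
  by rewrite big_nat_recr//= IH exprS; field.
have h0 : 0 <= 2^-1 ^+ n :> R by rewrite exprn_ge0// invr_ge0.
lra.
Qed.

Lemma often_large_limsup (t : R) : often_large t ->
  lim_sup_set rational_arcs (2 * pi * t).
Proof.
move=> [/andP[t0 t1] tirr large] N _.
have [h Nh lh] := large N; have dge := conv_den_ge t0 tirr h.
have dN := conv_den_gt0 t0 tirr h.
have := large_partial_quotient_error t0 tirr lh.
set d := conv_den t h in dge dN *; set c := conv_num t h => E.
have pi2 := pi_ge2 R; have d1 : 1 <= d%:R :> R by rewrite ler1n.
have D1 : d.+1%:R = d%:R + 1 :> R by rewrite -natr1.
pose e := `|2 * pi * (c%:R / d%:R) - 2 * pi * t|.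
have eE : e = 2 * pi * `|t - c%:R / d%:R|.
  by rewrite /e -mulrBr normrM distrC [X in X * _ = _]ger0_norm// mulr_ge0 ?pi_ge0.
have e0 : 0 <= e := normr_ge0 _.
have p2 : 1 <= 2 ^+ d :> R by rewrite exprn_ege1// ler1n.
have le1 : e * (d.+1%:R * 2 ^+ d) <= 1.
  apply: le_trans E; rewrite /= -eE ler_wpM2l// mulrC ler_wpM2r// -[leLHS]mul1r.
  apply: ler_pM => //; first by rewrite exprn_ege1.
  rewrite exprM ler_pXn2r ?nnegrE ?sqr_ge0//.
  by rewrite golden_sqr; have := golden_gt1 R; lra.
exists d => /=; first exact: leq_trans Nh dge.
exists c => /=.
  rewrite ltnS -ltnS -(ltr_nat R) D1.
  have de : d%:R * e <= 1.
    by apply: le_trans le1; rewrite mulrC ler_wpM2l// D1; nra.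
  have ce : `|t - c%:R / d%:R| <= e.
    by rewrite eE ler_peMl ?normr_ge0//; lra.
  have : c%:R / d%:R - t <= e.
    by apply: le_trans ce; rewrite distrC ler_norm.
  have cd : c%:R = d%:R * (c%:R / d%:R) :> R by field; rewrite gt_eqF// ltr0n.
  by rewrite [ltLHS]cd; nra.
rewrite /ball /= -/e; apply: (@le_lt_trans _ _ (d.+1%:R * 2 ^+ d)^-1).
  by rewrite -[leRHS]mul1r ler_pdivlMr// mulr_gt0// exprn_gt0.
by rewrite /arc_radius ltr_pMl ?ltr1n// invr_gt0 mulr_gt0// exprn_gt0.
Qed.

Lemma circle_null_often_large :
  circle_null [set exp2pii t | t in often_large].
Proof.
exists (lim_sup_set rational_arcs); split; last 1 first.
- move=> theta /= [/andP[th0 th2] [t tl]] tth.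
  have pi0 := pi_gt0 R.
  have -> : theta = 2 * pi * t; last exact: often_large_limsup.
  have E : t = theta / (2 * pi).
    have [/andP[t0 t1] _ _] := tl; apply: exp2pii_inj.
    - by rewrite t1 ltW.
    - by rewrite divr_ge0// ?ltr_pdivrMr ?mulr_gt0// ?mul1r ?th2// mulr_ge0// ltW.
    - by rewrite tth /exp2pii mulrC divfK// gt_eqF// mulr_gt0.
  by rewrite E mulrC divfK// gt_eqF// mulr_gt0.
- apply: bigcap_measurable => // k _; apply: bigcup_measurable => j _.
  exact: rational_arcs_measurable.
- exact: limsup_rational_arcs_null.
Qed.

End NullSet.

(** * The values at 1 and -1 *)

Section SpecialValues.
Variable R : realType.
Local Notation phi := (golden R).
Implicit Types (alpha : nat -> R[i]) (k : R[i]).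

Lemma chordal_le (z w : R[i]) : chordal (Some z) (Some w) <= normc (z - w).
Proof.
have ge1 (u : R[i]) : 1 <= Num.sqrt (1 + normc u ^+ 2).
  by rewrite -[leLHS]sqrtr1 ler_wsqrtr// lerDl sqr_ge0.
rewrite /= ler_pdivrMr ?mulr_gt0 ?(lt_le_trans _ (ge1 _))//.
by rewrite ler_peMr ?normc_ge0// mulr_ege1.
Qed.

(** A rate in terms of n./2 accommodates recurrences of period 2. *)
Lemma cf_converges_of_error alpha k (w : R) : 0 <= w < 1 ->
  (forall n, 1 <= normc (cf_den alpha (fun=> 1) n) /\
    normc (cf_num alpha (fun=> 1) n - k * cf_den alpha (fun=> 1) n) <= w ^+ n./2) ->
  cf_converges alpha (fun=> 1) (Some k).
Proof.
move=> /andP[w0 w1] err; apply/cvgrPdist_le => e e0.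
have wnorm : `|w| < 1 by rewrite ger0_norm.
have /cvgrPdist_le/(_ e e0)[M _ small] := cvg_geometric 1 wnorm.
exists M.*2 => // n /= Mn; rewrite sub0r normrN.
have [den1 err1] := err n.
have den0 : cf_den alpha (fun=> 1) n != 0.
  by apply/eqP => d0; move: den1; rewrite d0 normc0 ler10.
rewrite /Chat_div (negbTE den0).
rewrite ger0_norm; last by rewrite chordalE proj_dist_ge0.
rewrite (le_trans (chordal_le _ _))//.
have -> : cf_num alpha (fun=> 1) n / cf_den alpha (fun=> 1) n - k =
  (cf_num alpha (fun=> 1) n - k * cf_den alpha (fun=> 1) n) / cf_den alpha (fun=> 1) n.
  by field.
rewrite normcM normcV ler_pdivrMr ?(lt_le_trans _ den1)//.
rewrite (le_trans err1)// (@le_trans _ _ e)//; last by rewrite ler_peMr// ltW.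
have := small n./2; rewrite /= sub0r normrN mul1r ger0_norm ?exprn_ge0//.
by apply; rewrite /= -(doubleK M) half_leq.
Qed.

Lemma golden_conj : 0 < phi - 1 < 1.
Proof. by have := golden_gt1 R; have := golden_lt2 R; lra. Qed.

Lemma golden_inv : phi * (phi - 1) = 1.
Proof. by rewrite mulrBr mulr1 -expr2 golden_sqr; ring. Qed.

(** Fibonacci recurrence: A_n - phi B_n solves it with multiplier
    1 - phi = - 1 / phi, and B_n is a positive integer. *)
Lemma cf_converges_1 : cf_converges (K_alpha (1 : R[i])) (@K_b R) (Some (phi%:C)%C).
Proof.
have /andP[k0 k1] := golden_conj.
apply: (@cf_converges_of_error _ _ (phi - 1)); first by rewrite ltW.
pose P : R[i] := (phi%:C)%C; pose w : R[i] := ((1 - phi)%:C)%C.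
have ww : w ^+ 2 = w + 1.
  have E : (1 - phi) ^+ 2 = (1 - phi) + 1.
    by have g := golden_sqr R; ring: g.
  rewrite /w; move: (1 - phi) E => v E.
  by have := congr1 (real_complex R) E; rewrite rmorphXn rmorphD rmorph1.
have nw n : normc (w ^+ n) = (phi - 1) ^+ n.
  by rewrite normcX normc_real ltr0_norm ?opprB//; lra.
suff H n : exists b' b : nat, [/\ (0 < b)%N,
    cf_rec (K_alpha (1 : R[i])) (@K_b R) 0 1 n = (b'%:R, b%:R) &
    cf_rec (K_alpha (1 : R[i])) (@K_b R) 1 1 n =
      (P * b'%:R + w ^+ n, P * b%:R + w ^+ n.+1)].
  move=> n; rewrite /cf_num /cf_den.
  have [b' [b [b0 -> ->]]] := H n; rewrite [_.2]/=; split.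
    by rewrite -(rmorph_nat (real_complex R)) normc_real normr_nat ler1n.
  rewrite [_.2]/= addrC addKr nw ler_wiXn2l//; try lra.
  lia.
elim: n => [|n [b' [b [b0 E1 E2]]]].
  exists 0%N, 1%N; split=> //; congr pair; rewrite ?mulr0 ?add0r ?expr0//.
  by rewrite mulr1 expr1 -rmorphD /= addrC subrK.
exists b, (b + b')%N; split; first by rewrite addn_gt0 b0.
  by rewrite /= E1 /K_alpha expr1n /K_b !mul1r natrD.
rewrite /= E2 /K_alpha expr1n /K_b !mul1r natrD; congr pair.
by rewrite [w ^+ n.+2]exprS exprS mulrA -expr2 ww; ring.
Qed.

(** The recurrence alternates between u_n = u_{n-1} - u_{n-2} and
    u_n = u_{n-1} + u_{n-2}. Two steps multiply A_n - (phi - 1) B_n by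
    - (phi - 1) = - 1 / phi, and the denominators remain positive integers. *)
Lemma cf_converges_N1 :
  cf_converges (K_alpha (- 1 : R[i])) (@K_b R) (Some ((phi - 1)%:C)%C).
Proof.
have /andP[k0 k1] := golden_conj.
apply: (@cf_converges_of_error _ _ (phi - 1)); first by rewrite ltW.
pose k : R[i] := ((phi - 1)%:C)%C; rewrite -/k.
have kk : k ^+ 2 = 1 - k.
  have E : (phi - 1) ^+ 2 = 1 - (phi - 1).
    by have g := golden_sqr R; ring: g.
  rewrite /k; move: (phi - 1) E => v E.
  by have := congr1 (real_complex R) E; rewrite rmorphXn rmorphB rmorph1.
have nk n : normc ((- k) ^+ n) = (phi - 1) ^+ n.
  by rewrite normcX normc_opp normc_real ger0_norm// ltW.
(* Even indices first; the bound b' < b keeps the odd denominators b - b'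
   positive. *)
have even m : exists b' b : nat, [/\ (b' < b)%N,
    cf_rec (K_alpha (- 1 : R[i])) (@K_b R) 0 1 m.*2 = (b'%:R, b%:R) &
    cf_rec (K_alpha (- 1 : R[i])) (@K_b R) 1 1 m.*2 =
      (k * b'%:R + (- k) ^+ m, k * b%:R + (- k) ^+ m * (1 - k))].
  elim: m => [|m [b' [b [b0 E1 E2]]]].
    exists 0%N, 1%N; split=> //; congr pair; rewrite ?mulr0 ?add0r ?expr0//.
    by rewrite mulr1 mul1r addrC subrK.
  have sg1 : K_alpha (- 1 : R[i]) m.*2.+1 = -1.
    by rewrite /K_alpha -signr_odd /= odd_double.
  have sg2 : K_alpha (- 1 : R[i]) m.*2.+2 = 1.
    by rewrite /K_alpha -signr_odd /= odd_double.
  exists (b - b')%N, (b - b' + b)%N; split; first by lia.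
    rewrite doubleS /= E1 sg1 sg2 /K_b !mul1r natrD natrB; last exact: ltnW.
    by rewrite mulN1r.
  rewrite doubleS /= E2 sg1 sg2 /K_b !mul1r natrD natrB; last exact: ltnW.
  congr pair; rewrite exprS mulN1r; first by ring.
  move: ((- k) ^+ m) => K; apply/eqP; rewrite -subr_eq0; apply/eqP.
  by transitivity (K * (1 - k - k ^+ 2)); [ring | rewrite kk subrr mulr0].
have k1' : normc (1 - k) <= 1.
  by rewrite -kk normcX normc_real exprn_ile1// ger0_norm// ltW.
move=> n; rewrite /cf_num /cf_den -{1 2 3}(odd_double_half n).
have [b' [b [b0 E1 E2]]] := even n./2.
have b1 : (1 <= b)%N by lia.
have natN m : normc (m%:R : R[i]) = m%:R.
  by rewrite -(rmorph_nat (real_complex R)) normc_real normr_nat.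
case: (odd n); rewrite ?add0n ?add1n /=; last first.
  rewrite E1 E2 natN ler1n b1 [_.2]/= [_.2]/= addrC addKr normcM nk.
  by split=> //; rewrite ler_piMr// exprn_ge0// ltW.
have sg1 : K_alpha (- 1 : R[i]) (n./2).*2.+1 = -1.
  by rewrite /K_alpha -signr_odd /= odd_double.
rewrite E1 E2 sg1 /K_b !mul1r !mulN1r [_.2]/= [_.2]/= -natrB 1?ltnW// natN.
rewrite ler1n subn_gt0 b0 natrB 1?ltnW//; split=> //.
have -> : k * b%:R + (- k) ^+ n./2 * (1 - k) - (k * b'%:R + (- k) ^+ n./2) -
  k * (b%:R - b'%:R) = - k * (- k) ^+ n./2 by ring.
rewrite normcM nk normc_opp normc_real ger0_norm ?(ltW k0)//.
by rewrite ler_piMl ?exprn_ge0 ?ltW.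
Qed.

Lemma rr_value_1 : rr_value (exp2pii (0%:R / 1%:R)) (RR R 10).
Proof.
exists 0, (phi%:C)%C; split=> //.
- by rewrite lexx ltr01.
- by rewrite mul0r.
- by rewrite mul0r exp2pii0; exact: cf_converges_1.
- apply/eqP => /(congr1 (@complex.Re R)) /= /eqP; rewrite gt_eqF//.
  by have := golden_gt1 R; lra.
- rewrite /RR /= mul0r exp2pii0; congr (_ / _).
  have -> : 10 / 5 = 2%:R :> R by field.
  exact: exp2pii_nat.
Qed.

Lemma exp2pii_half : exp2pii (1 / 2) = -1 :> R[i].
Proof.
rewrite /exp2pii (_ : 2 * pi * (1 / 2) = pi); last by field.
by rewrite /expi cospi sinpi; apply/eqP; rewrite eq_complex /= oppr0 !eqxx.
Qed.

Lemma rr_value_N1 : rr_value (exp2pii (1%:R / 2%:R)) (RR R 3).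
Proof.
have /andP[k0 k1] := golden_conj.
have kn0 : ((phi - 1)%:C)%C != 0 :> R[i].
  by apply/eqP => /(congr1 (@complex.Re R)) /= /eqP; rewrite gt_eqF.
exists (1 / 2), ((phi - 1)%:C)%C; split=> //.
- by lra.
- by rewrite exp2pii_half; exact: cf_converges_N1.
- rewrite /RR /=.
  have -> : 3 / 5 = 1 / 2 / 5 + 1 / 2 :> R by field.
  rewrite exp2piiD exp2pii_half; apply: (mulIf kn0); rewrite divfK//.
  rewrite mulrN1 mulrNN mulrAC -rmorphM.
  by rewrite [phi * (phi - 1)]golden_inv rmorph1 mul1r.
Qed.

Lemma RR_10_neq_3 : RR R 10 != RR R 3.
Proof.
apply/eqP => /(congr1 (@normc R)); rewrite /RR /= !normcM normcV normc_opp.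
rewrite !normc_expi mul1r mulr1 normc_real; have phi1 : 1 < phi := golden_gt1 R.
rewrite gtr0_norm; last by lra.
move=> E; have : phi * phi = 1 by rewrite -[X in X * _]E mulVf// gt_eqF//; lra.
by nra.
Qed.

End SpecialValues.

(** * Uncountability *)

Section Uncountable.
Variable R : realType.

Definition quotient_bound (q : nat) : R :=
  2 * pi * q.+1%:R ^+ 2 * golden R ^+ (q ^ 2 + 2 * q).
(** With |q t - p| < q * radius, the next partial quotient exceeds
    1 / (q^2 radius) - 2, which is the required bound. *)
Definition well_radius (q : nat) : R := (q%:R ^+ 2 * (quotient_bound q + 2))^-1.
(** 2^(4k+i) = 16^k 2^i is congruent to 2^i modulo 5 and coprime to every odd
    number, so that coprimality and both residues are immediate. *)
Definition well_den (i k : nat) : nat := (2 ^ (4 * k + i))%N.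
Definition well_num (e j : nat) : nat := (10 * j + e)%N.
(** The half line of negative reals is added in order to make the set dense in
    the whole line with natural numbers as numerators. *)
Definition wells (e i N : nat) : set R := [set x | x < 0] `|`
  \bigcup_(kj in [set kj : nat * nat | (N <= kj.1)%N])
    ball ((well_num e kj.2)%:R / (well_den i kj.1)%:R : R)
      (well_radius (well_den i kj.1)).

Lemma quotient_bound_ge0 q : 0 <= quotient_bound q.
Proof.
have phi1 := golden_gt1 R; have pi0 := pi_gt0 R.
by rewrite /quotient_bound !mulr_ge0 ?sqr_ge0// ?exprn_ge0//; lra.
Qed.

Lemma well_den_gt0 i k : (0 < well_den i k)%N. Proof. by rewrite expn_gt0. Qed.

Lemma well_radius_gt0 i k : 0 < well_radius (well_den i k).
Proof.
rewrite /well_radius invr_gt0 mulr_gt0 ?exprn_gt0 ?ltr0n ?well_den_gt0//.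
by have := quotient_bound_ge0 (well_den i k); lra.
Qed.

Lemma well_den_ge i k : (k <= well_den i k)%N.
Proof.
by rewrite (leq_trans (ltnW (ltn_expl k (ltnSn 1))))// leq_exp2l//; lia.
Qed.

Lemma wells_open e i N : open (wells e i N).
Proof.
apply: openU; first exact: open_lt.
by apply: bigcup_open => kj _; exact: ball_open.
Qed.

(** The numerators 10 j + e, divided by a denominator q, form a grid of mesh
    10 / q. *)
Lemma wells_dense e i N : (e < 10)%N -> dense (wells e i N).
Proof.
move=> e10 O [x Ox] oO.
have [x0|x0] := ltP x 0; first by exists x; split=> //; left.
have /nbhs_ballP[r /= r0 rO] : nbhs x O by apply: open_nbhs_nbhs.
pose k := (maxn N (Num.truncn (10 / r)).+1).
pose q := well_den i k.
have q0 : 0 < q%:R :> R by rewrite ltr0n well_den_gt0.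
have qr : 10 / q%:R < r.
  rewrite ltr_pdivrMr// mulrC -ltr_pdivrMr//.
  apply: (@lt_le_trans _ _ k%:R); last by rewrite ler_nat well_den_ge.
  apply: (@lt_le_trans _ _ (Num.truncn (10 / r)).+1%:R).
    exact: truncnS_gt.
  by rewrite ler_nat leq_maxr.
pose j := Num.truncn (x * q%:R / 10).
have j0 : 0 <= x * q%:R / 10 by rewrite divr_ge0// mulr_ge0// ltW.
have /andP[j1 j2] := truncn_itv j0; rewrite -/j -?[j.+1%:R]natr1 in j1 j2.
exists ((well_num e j)%:R / q%:R); split.
  apply: rO; rewrite /ball /=; apply: le_lt_trans qr.
  rewrite ler_pdivlMr// -[X in _ * X]gtr0_norm// -normrM mulrBl divfK ?gt_eqF//.
  have e0 : 0 <= e%:R :> R by [].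
  have e10' : e%:R <= 10 :> R by rewrite ler_nat ltnW.
  rewrite /well_num natrD natrM ler_norml; apply/andP; split; lra.
right; exists (k, j) => /=; first by rewrite leq_maxl.
exact: ballxx (well_radius_gt0 _ _).
Qed.

Definition good_convergent (t : R) (r s h : nat) : Prop :=
  [/\ conv_num t h = r %[mod 5], conv_den t h = s %[mod 5] &
      large_partial_quotient t h].

(** For a convergent of index beyond H, take k larger than the denominator of
    the convergent of index H: denominators do not decrease. *)
Lemma wells_good (t : R) (e i : nat) : odd e -> 0 < t -> irrational t ->
  (forall N, wells e i N t) ->
  forall H, exists2 h, (H < h)%N & good_convergent t e (2 ^ i) h.
Proof.
move=> oe t0 tirr tw H.
have [|[[k j] /= Nk]] := tw (conv_den t H).+1.
  by move=> /= tneg; exfalso; lra.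
set p := well_num e j; set q := well_den i k; rewrite /ball /= distrC => close.
have q0 : 0 < q%:R :> R by rewrite ltr0n well_den_gt0.
have l0 := quotient_bound_ge0 q.
have pq : coprime p q.
  by rewrite coprimeXr// coprimen2 /p /well_num oddD oddM.
have err : `|q%:R * t - p%:R| < q%:R * well_radius q.
  have -> : q%:R * t - p%:R = q%:R * (t - p%:R / q%:R) by field; rewrite gt_eqF.
  by rewrite normrM gtr0_norm// ltr_pM2l.
have qn0 : q%:R != 0 :> R by rewrite gt_eqF.
have Ln0 : quotient_bound q + 2 != 0 by rewrite gt_eqF//; lra.
have radiusE : q%:R * well_radius q = (q%:R * (quotient_bound q + 2))^-1.
  rewrite /well_radius; move: (quotient_bound q + 2) Ln0 => L Ln0.
  by field; rewrite qn0 Ln0.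
have [h [ch dh]] : exists h, conv_num t h = p /\ conv_den t h = q.
  apply: legendre_convergent => //; first exact: well_den_gt0.
  have L0 : 0 < quotient_bound q + 2 by lra.
  apply: (lt_le_trans err); rewrite radiusE lef_pV2 ?posrE ?mulr_gt0//.
  have q0' := ltW q0; rewrite [leLHS]mulrC ler_wpM2l//; lra.
exists h.
  rewrite ltnNge; apply/negP => /(conv_den_homo t0 tirr).
  by rewrite dh leqNgt (leq_trans Nk (well_den_ge i k)).
rewrite /good_convergent ch dh; split.
- by rewrite /p /well_num -[10%N]/(2 * 5)%N mulnAC modnMDl.
- by rewrite /q /well_den expnD expnM -modnMml -modnXm exp1n mul1n.
- rewrite /large_partial_quotient dh -/(quotient_bound q).
  have e0 : 0 < q%:R * well_radius q by rewrite mulr_gt0// well_radius_gt0.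
  have := @partial_quotient_gt R t t0 tirr h _ e0.
  rewrite /conv_err ch dh => /(_ err); rewrite radiusE.
  have -> : q%:R / (q%:R * (quotient_bound q + 2)) = (quotient_bound q + 2)^-1.
    by move: (quotient_bound q + 2) Ln0 => L Ln0; field; rewrite qn0 Ln0.
  by rewrite invrK; lra.
Qed.

Lemma frequent_subsequence (P : nat -> Prop) :
  (forall H, exists2 h, (H < h)%N & P h) ->
  exists f : nat -> nat, {homo f : m n / (m < n)%N} /\ forall n, P (f n).
Proof.
move=> freq; have /choice[nx nxP] : forall H, exists h, (H < h)%N /\ P h.
  by move=> H; have [h] := freq H; exists h.
exists (fun n => iter n.+1 nx 0%N); split; last first.
  by move=> n; case: (nxP (iter n nx 0%N)).
apply: homo_ltn => [y x z|n]; first exact: ltn_trans.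
by case: (nxP (iter n.+1 nx 0%N)).
Qed.

Lemma wells_Sdiamond (t : R) : 0 < t < 1 -> irrational t ->
  (forall N, wells 5 0 N t /\ wells 1 1 N t) -> Sdiamond t.
Proof.
move=> t01 tirr tw; have /andP[t0 _] := t01; split=> //.
have [f [f_incr fP]] := frequent_subsequence
  (wells_good (isT : odd 5) t0 tirr (fun N => (tw N).1)).
have [g [g_incr gP]] := frequent_subsequence
  (wells_good (isT : odd 1) t0 tirr (fun N => (tw N).2)).
exists f, g, 0%N, 1%N, 1%N, 2%N; split=> // [n|n|].
- by have [? ? _] := fP n; have [? ? _] := gP n.
- by have [_ _ ?] := fP n; have [_ _ ?] := gP n.
exists 10%N, 3%N; split=> //; first exact: rr_value_1.
- exact: rr_value_N1.
- exact: RR_10_neq_3.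
Qed.

Lemma subsingleton_compl (A : set R) : (forall x y, A x -> A y -> x = y) ->
  open (~` A) /\ dense (~` A).
Proof.
move=> A1; have [[a Aa]|A0] := pselect (exists a, A a).
  have -> : A = [set a] by apply/seteqP; split=> [x Ax|x ->//]; exact: A1.
  split; last exact: dense_set1C.
  rewrite openC; exact/accessible_closed_set1/hausdorff_accessible/Rhausdorff.
have -> : A = set0 by apply/seteqP; split=> // x Ax; apply: A0; exists x.
rewrite setC0; split; first exact: openT.
by move=> O O0 _; rewrite setIT.
Qed.

(** The irrationals of (0, 1) that lie in all the wells belong to the set. They
    are residual in (0, 1) and remain so after the removal of countably many
    points, so Baire's theorem yields one that escapes a given enumeration. *)
Lemma Sdiamond_uncountable : ~ countable (@exp2pii R @` @Sdiamond R).
Proof.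
move=> /countable_injP[f finj].
have qinj (s t : R) : Sdiamond s -> Sdiamond t ->
    f (exp2pii s) = f (exp2pii t) -> s = t.
  move=> Ss St E; have [/andP[s0 s1] _ _] := Ss; have [/andP[t0 t1] _ _] := St.
  apply: exp2pii_inj; rewrite ?(ltW s0) ?(ltW t0)//.
  by apply: finj => //; rewrite inE; [exists s | exists t].
have [B oB irrB] := @irrational_Gdelta R.
(* As f separates the points of the set, V n misses at most one point. *)
pose V n : set R := ~` [set t | Sdiamond t /\ f (exp2pii t) = n].
have oV n : open (V n) /\ dense (V n).
  by apply: subsingleton_compl => s t [Ss <-] [St /esym E]; exact: qinj.
pose F n : set R := (wells 5 0 n `&` wells 1 1 n) `&` (B n `&` V n).
have oF n : open (F n) /\ dense (F n).
  have [oBn dBn] := oB n; have [oVn dVn] := oV n.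
  have oW := openI (@wells_open 5 0 n) (@wells_open 1 1 n).
  split; first exact/openI/openI.
  apply: denseI => //; last exact: denseI.
  by apply: denseI; [exact: wells_open | exact: wells_dense..].
have O0 : [set t : R | 0 < t < 1] !=set0 by exists (1 / 2) => /=; lra.
have oO : open [set t : R | 0 < t < 1].
  have -> : [set t : R | 0 < t < 1] = [set t | 0 < t] `&` [set t | t < 1].
    by apply/seteqP; split=> t /=; [move=> /andP[]|move=> [-> ->]].
  by apply: openI; [exact: open_gt | exact: open_lt].
have [t [t01 tF]] := Baire oF O0 oO.
have St : Sdiamond t.
  apply: wells_Sdiamond => //.
    by rewrite irrB => n _; have [_ []] := tF n Logic.I.
  by move=> N; have [[]] := tF N Logic.I.
have [_ [_ Vt]] := tF (f (exp2pii t)) Logic.I.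
exact: Vt.
Qed.

End Uncountable.

Theorem theorem3 (R : realType) :
  let G : set R[i] := [set exp2pii t | t in @Sdiamond R] in
  [/\ ~ countable G,
      circle_null G &
      forall y : R[i], G y -> ~ cf_converges_generally (K_alpha y) (@K_b R)].
Proof.
move=> G; split.
- exact: Sdiamond_uncountable.
- apply: negligibleS (circle_null_often_large R) => theta /= [-> [t St tE]].
  by split=> //; exists t => //; exact: Sdiamond_often_large.
- move=> y [t /Sdiamond_often_large [/andP[t0 _] tirr large] <-].
  exact: rogers_ramanujan_not_cvg_generally.
Qed.
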